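(* Let $(X,\tau_X)$ be a Polish space and $T:X\to X$ be $\tau_X$-continuous. Assume $X$ is endowed with a Hausdorff topology $\tau$ coarser than $\tau_X$ such that every point has a $\tau_X$-neighbourhood basis consisting of $\tau$-compact sets, and that $T$ is a homeomorphism of $(X,\tau)$. Then the following are equivalent: (1) $T$ admits an ergodic Borel probability measure with full support; (2) there exists $x_0\in X$ such that for every nonempty $\tau_X$-open set $V$, $$\lim_{N\to\infty}\underline{\mathrm{dens}}\bigcup_{r=0}^N\big(\mathcal N_T(x_0,V)-r\big)=1.$$
   Context: $\mathcal N_T(x,V)=\{n\in\mathbb N:T^nx\in V\}$; $D-r=\{d-r: d\in D\}$; $\underline{\mathrm{dens}}(D)=\liminf_N\frac1N\#(D\cap[1,N])$. Full support means positive measure on every nonempty $\tau_X$-open set. *)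

(* Defs.v *)
From HB Require Import structures.
From mathcomp Require Import all_boot all_order all_algebra.
From mathcomp Require Import all_classical all_reals all_analysis.
Set Implicit Arguments. Unset Strict Implicit. Unset Printing Implicit Defensive.
Import Order.TTheory GRing.Theory Num.Theory.
Local Open Scope classical_set_scope.
Local Open Scope ring_scope.

(* Topologies on a carrier X are given as set systems (the family of open sets),
   since the statement involves two different topologies on the same set. *)
Section Topo.
Context {X : Type}.

Definition is_topology (O : set (set X)) : Prop :=
  [/\ O setT, O set0,
      (forall U V, O U -> O V -> O (U `&` V)) &
      (forall C : set (set X), C `<=` O -> O (\bigcup_(U in C) U))].

Definition coarser (O1 O2 : set (set X)) : Prop := O1 `<=` O2.

Definition hausdorff_top (O : set (set X)) : Prop :=
  forall x y : X, x <> y ->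
    exists U V, [/\ O U, O V, U x, V y & U `&` V = set0].

Definition compact_in (O : set (set X)) (K : set X) : Prop :=
  forall C : set (set X), C `<=` O -> K `<=` \bigcup_(U in C) U ->
    exists (n : nat) (f : 'I_n -> set X), (forall i, C (f i)) /\
      (forall x, K x -> exists i, f i x).

Definition nbhs_in (O : set (set X)) (x : X) (N : set X) : Prop :=
  exists U, [/\ O U, U x & U `<=` N].

Definition compact_nbhs_basis (O O' : set (set X)) : Prop :=
  forall x U, O U -> U x ->
    exists K, [/\ nbhs_in O x K, K `<=` U & compact_in O' K].

Definition continuous_in (O : set (set X)) (T : X -> X) : Prop :=
  forall U, O U -> O (T @^-1` U).

Definition homeomorphism_in (O : set (set X)) (T : X -> X) : Prop :=
  exists S : X -> X, [/\ cancel T S, cancel S T,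
                         continuous_in O T & continuous_in O S].

Definition polish_top (R : realType) (O : set (set X)) : Prop :=
  exists d : X -> X -> R,
    [/\ (forall x y, 0 <= d x y) /\ (forall x y, d x y = 0 <-> x = y),
        (forall x y, d x y = d y x) /\
        (forall x y z, d x z <= d x y + d y z),
        (forall U, O U <-> forall x, U x ->
            exists2 e : R, 0 < e & [set y | d x y < e] `<=` U),
        (forall u : nat -> X,
           (forall e : R, 0 < e -> exists N, forall m n, (N <= m)%N -> (N <= n)%N ->
                d (u m) (u n) < e) ->
           exists l, forall e : R, 0 < e -> exists N, forall n, (N <= n)%N ->
                d (u n) l < e) &
        (exists D : set X, countable D /\
           forall U, O U -> U !=set0 -> D `&` U !=set0)].
End Topo.

Definition return_times {X : Type} (T : X -> X) (x : X) (V : set X) : set nat :=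
  [set n | V (iter n T x)].

Definition shift_set (D : set nat) (r : nat) : set int :=
  [set z | exists2 d, D d & z = (d%:Z - r%:Z)%R].

Definition shifted_union (D : set nat) (N : nat) : set int :=
  \bigcup_(r in [set r : nat | (r <= N)%N]) shift_set D r.

Definition lower_dens (R : realType) (D : set int) : \bar R :=
  limn_einf (fun M : nat =>
    ((\sum_(1 <= k < M.+1) (\1_D (k%:Z) : R)) / M%:R)%:E).

Section Erg.
Context {d : measure_display} {X : measurableType d} {R : realType}.
Local Open Scope ereal_scope.

Definition invariant_measure (T : X -> X) (mu : set X -> \bar R) : Prop :=
  forall A, measurable A -> mu (T @^-1` A) = mu A.

Definition ergodic_measure (T : X -> X) (mu : probability X R) : Prop :=
  invariant_measure T mu /\
  forall A, measurable A -> T @^-1` A = A -> mu A = 0 \/ mu A = 1.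

Definition full_support (O : set (set X)) (mu : set X -> \bar R) : Prop :=
  forall U, O U -> U !=set0 -> 0 < mu U.
End Erg.

(* Main.v *)
Require Import Defs.
From HB Require Import structures.
From mathcomp Require Import all_boot all_order all_algebra.
From mathcomp Require Import all_classical all_reals all_analysis.
From mathcomp Require Import measurable_realfun ring lra.
Import Order.TTheory GRing.Theory Num.Theory.
Import numFieldNormedType.Exports.
Local Open Scope classical_set_scope.
Local Open Scope ring_scope.

(* (1) => (2).  By ergodicity almost every orbit visits V, so the sets of points
   visiting V before time N have measure tending to 1.  The maximal ergodic
   inequality shows that for measurable A and a < mu A, the Birkhoff sums of
   a - 1_A are bounded above at almost every point, so almost every orbit visits
   A with lower density at least a; apply this along a countable base.

   (2) => (1).  Since T is a tau-homeomorphism, (2) provides tau-compact sets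
   (finite unions of T^-r L, with L a compact neighbourhood) in which the orbit
   of x0 spends a proportion of time close to 1: the empirical measures are
   tight.  A tight invariant finitely additive limit p yields an invariant Borel
   probability m with m K >= p K on tau-compact sets, by the outer measure
   construction from contents (which needs no local compactness).  Ergodicity is
   obtained without ergodic decomposition: among invariant probabilities, minimize
     sum_i 8 * 2^i * (1 - m (C i)) + sum_i 2^-i * (1 - (m (K i))^2),
   where the compacts C i detect the open sets and (K i) is a countable pi-system
   of compacts generating the Borel sets.  Finiteness of the first sum keeps
   minimizing sequences tight and the minimizer fully supported; strict concavity
   of the second makes the minimizer extreme, hence ergodic. *)

Set Implicit Arguments.
Unset Strict Implicit.
Unset Printing Implicit Defensive.

(** * Compactness in a topology given as a set system *)

Section topology_set_system.
Context {X : Type} (O : set (set X)).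
Hypothesis hO : is_topology O.

Lemma open_setU (U V : set X) : O U -> O V -> O (U `|` V).
Proof.
move=> oU oV; case: hO => _ _ _ /(_ [set U; V]).
by rewrite bigcup_setU !bigcup_set1; apply => _ [|] ->.
Qed.

Lemma open_bigcup (I : Type) (D : set I) (F : I -> set X) :
  (forall i, D i -> O (F i)) -> O (\bigcup_(i in D) F i).
Proof.
move=> oF; case: hO => _ _ _ /(_ (F @` D)).
by rewrite bigcup_image; apply => _ [i Di <-]; exact: oF.
Qed.

Lemma open_locally (U : set X) :
  (forall x, U x -> exists V, [/\ O V, V x & V `<=` U]) -> O U.
Proof.
move=> h; have -> : U = \bigcup_(V in [set V | O V /\ V `<=` U]) V.
  apply/seteqP; split => [x Ux|x [V [_ VU]]]; last exact: VU.
  by have [V [oV Vx VU]] := h x Ux; exists V.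
by apply: open_bigcup => V [].
Qed.


Definition set_ideal (P : set X -> Prop) : Prop :=
  [/\ P set0, (forall A B, P A -> P B -> P (A `|` B)) &
      (forall A B, A `<=` B -> P B -> P A)].

(** Compactness as an induction principle: what holds locally and is stable under finite unions and
    subsets holds on [K]. Conversely, the sets with a finite subcover from [C] form an ideal. *)
Lemma compact_in_idealP (K : set X) : compact_in O K <->
  (forall P, set_ideal P ->
    (forall x, K x -> exists U, [/\ O U, U x & P U]) -> P K).
Proof.
split=> [cK P [P0 PU Ple] h|h C CO KC].
  have [||n [f [Cf Kf]]] := cK [set U | O U /\ P U]; first by move=> U [].
    by move=> x /h [U [oU Ux PUx]]; exists U.
  apply: (Ple _ (\big[setU/set0]_(i < n) f i)).
    move=> x /Kf [i fix_]; rewrite -bigcup_seq; exists i => //=.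
    by rewrite mem_index_enum.
  by elim/big_ind : _ => // i _; case: (Cf i).
pose P A := exists (n : nat) (f : 'I_n -> set X), (forall i, C (f i)) /\
  (forall x, A x -> exists i, f i x).
apply: (h P).
  split.
  - by exists 0%N, (fun=> set0); split => // -[].
  - move=> A B [n [f [Cf Af]]] [m [g [Cg Bg]]].
    exists (n + m)%N,
      (fun i => match fintype.split i with inl j => f j | inr j => g j end); split.
      by move=> i; case: (fintype.split i).
    move=> x [/Af [i fx]|/Bg [i gx]].
      by exists (unsplit (inl i)); rewrite unsplitK.
    by exists (unsplit (inr i)); rewrite unsplitK.
  - by move=> A B AB [n [f [Cf Bf]]]; exists n, f; split => // x /AB /Bf.
move=> x /KC [U CU Ux]; exists U; split => //; first exact: CO.
by exists 1%N, (fun=> U); split => // y Uy; exists ord0.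
Qed.

Lemma compact_in_set0 : compact_in O set0.
Proof. by apply/compact_in_idealP => P []. Qed.

Lemma compact_in_setU (K L : set X) :
  compact_in O K -> compact_in O L -> compact_in O (K `|` L).
Proof.
move=> /compact_in_idealP cK /compact_in_idealP cL.
apply/compact_in_idealP => P iP h; have [_ PU _] := iP; apply: PU.
  by apply: cK => // x Kx; apply: h; left.
by apply: cL => // x Lx; apply: h; right.
Qed.

Lemma compact_in_bigsetU (n : nat) (F : nat -> set X) :
  (forall i, compact_in O (F i)) -> compact_in O (\big[setU/set0]_(i < n) F i).
Proof.
move=> cF; elim/big_ind : _ => // [|A B]; [exact: compact_in_set0|].
exact: compact_in_setU.
Qed.

Lemma compact_in_setD (K U : set X) :
  compact_in O K -> O U -> compact_in O (K `\` U).
Proof.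
move=> /compact_in_idealP cK oU; apply/compact_in_idealP => P [P0 PU Ple] h.
(* With this ideal, a point of [U] has the neighbourhood [U] itself, since [U] minus [U] is
   empty. *)
apply: (cK (fun A => P (A `\` U))).
  split; first by rewrite set0D.
    by move=> A B PA PB; rewrite setDUl; exact: PU.
  by move=> A B AB; apply: Ple; exact: setSD.
move=> x Kx; have [Ux|nUx] := pselect (U x).
  by exists U; split => //; rewrite setDv.
have [|V [oV Vx PV]] := h x; first by split.
by exists V; split => //; apply: Ple PV => y [].
Qed.

Lemma compact_in_image (K : set X) (f : X -> X) :
  compact_in O K -> continuous_in O f -> compact_in O (f @` K).
Proof.
move=> /compact_in_idealP cK cf; apply/compact_in_idealP => P [P0 PU Ple] h.
apply: (cK (fun A => P (f @` A))).
  split; first by rewrite image_set0.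
    by move=> A B PA PB; rewrite image_setU; exact: PU.
  by move=> A B AB; apply: Ple; exact: image_subset.
move=> x Kx; have [|V [oV Vx PV]] := h (f x); first by exists x.
exists (f @^-1` V); split => //; first exact: cf.
by apply: Ple PV => _ [y Vy <-].
Qed.

Lemma homeomorphism_in_compact_preimage (K : set X) (f : X -> X) :
  homeomorphism_in O f -> compact_in O K -> compact_in O (f @^-1` K).
Proof.
move=> [g [fg gf cf cg]] cK.
suff -> : f @^-1` K = g @` K by exact: compact_in_image.
apply/seteqP; split => [x Kx|_ [y Ky <-]]; first by exists (f x).
by rewrite /= gf.
Qed.

Hypothesis hausO : hausdorff_top O.

(** The sets that can be separated from [x] form an ideal, and the Hausdorff property is the local
    case. *)
Lemma compact_in_sep_point (K : set X) (x : X) : compact_in O K -> ~ K x ->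
  exists U V, [/\ O U, O V, K `<=` U, V x & U `&` V = set0].
Proof.
move=> /compact_in_idealP cK nKx; have [OT O0 OI _] := hO.
apply: (cK (fun A => exists U V, [/\ O U, O V, A `<=` U, V x & U `&` V = set0])).
  split; first by exists set0, setT; split => //; rewrite set0I.
    move=> A B [U [V [oU oV AU Vx UV]]] [U' [V' [oU' oV' BU Vx' UV']]].
    exists (U `|` U'), (V `&` V'); split => //.
    - exact: open_setU.
    - exact: OI.
    - exact: setUSS.
    - apply/seteqP; split=> // y [[Uy|Uy] [Vy Vy']].
        by rewrite -UV.
      by rewrite -UV'.
  by move=> A B AB [U [V [oU oV BU Vx UV]]]; exists U, V; split=> // y /AB /BU.
move=> y Ky; have [|U [V [oU oV Uy Vx UV]]] := @hausO y x.
  by move=> yx; apply: nKx; rewrite -yx.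
by exists U; split => //=; exists U, V; split.
Qed.

Lemma compact_in_open_setC (K : set X) : compact_in O K -> O (~` K).
Proof.
move=> cK; apply: open_locally => x nKx.
have [U [V [oU oV KU Vx UV]]] := compact_in_sep_point cK nKx.
exists V; split => // y Vy Ky.
by have : (U `&` V) y by [split => //; exact: KU]; rewrite UV.
Qed.

Lemma compact_in_setI (K L : set X) :
  compact_in O K -> compact_in O L -> compact_in O (K `&` L).
Proof.
move=> cK cL; rewrite -[L]setCK -setDE; apply: compact_in_setD => //.
exact: compact_in_open_setC.
Qed.

Lemma compact_in_sep (K L : set X) : compact_in O K -> compact_in O L ->
  K `&` L = set0 ->
  exists U V, [/\ O U, O V, K `<=` U, L `<=` V & U `&` V = set0].
Proof.
move=> cK /compact_in_idealP cL KL; have [OT O0 OI _] := hO.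
apply: (cL (fun A =>
    exists U V, [/\ O U, O V, K `<=` U, A `<=` V & U `&` V = set0])).
  split; first by exists setT, set0; split => //; rewrite setI0.
    move=> A B [U [V [oU oV KU AV UV]]] [U' [V' [oU' oV' KU' BV UV']]].
    exists (U `&` U'), (V `|` V'); split => //.
    - exact: OI.
    - exact: open_setU.
    - by move=> x Kx; split; [exact: KU|exact: KU'].
    - exact: setUSS.
    - apply/seteqP; split=> // y [[Uy Uy'] [Vy|Vy]].
        by rewrite -UV.
      by rewrite -UV'.
  by move=> A B AB [U [V [oU oV KU BV UV]]]; exists U, V; split=> // y /AB /BV.
move=> x Lx; have [|U [V [oU oV KU Vx UV]]] := @compact_in_sep_point K x cK.
  by move=> Kx; have : (K `&` L) x by []; rewrite KL.
by exists V; split => //=; exists U, V; split.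
Qed.

(** The compact sets [K] minus [U] and [K] minus [V] are disjoint. Separating them by open [U'] and
    [V'] and removing each of these from [K] gives the two pieces. *)
Lemma compact_in_setU_split (K U V : set X) : compact_in O K -> O U -> O V ->
  K `<=` U `|` V -> exists K1 K2, [/\ compact_in O K1, compact_in O K2,
    K1 `<=` U, K2 `<=` V & K = K1 `|` K2].
Proof.
move=> cK oU oV KUV.
have [|||U' [V' [oU' oV' KU KV UV]]] := @compact_in_sep (K `\` U) (K `\` V).
- exact: compact_in_setD.
- exact: compact_in_setD.
- by apply/seteqP; split=> // x [[Kx nU] [_ nV]]; case: (KUV x Kx).
exists (K `\` U'), (K `\` V'); split.
- exact: compact_in_setD.
- exact: compact_in_setD.
- by move=> x [Kx nU]; apply: contrapT => nUx; apply: nU; exact: KU.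
- by move=> x [Kx nV]; apply: contrapT => nVx; apply: nV; exact: KV.
- rewrite -setDIr UV setD0//.
Qed.
End topology_set_system.

(** * Infima and suprema of real-valued functions over a set *)

Section inf_image.
Context {R : realType} {I : Type}.
Implicit Types (S : set I) (f : I -> R).

Lemma inf_image_le S f c i : (forall j, S j -> c <= f j) -> S i ->
  inf (f @` S) <= f i.
Proof.
move=> lb Si; apply: ge_inf; last by exists i.
by exists c => _ [j Sj <-]; exact: lb.
Qed.

Lemma inf_image_ge S f c : S !=set0 -> (forall j, S j -> c <= f j) ->
  c <= inf (f @` S).
Proof.
move=> [i Si] lb; apply: lb_le_inf; first by exists (f i), i.
by move=> _ [j Sj <-]; exact: lb.
Qed.

Lemma inf_image_lt S f c : S !=set0 -> inf (f @` S) < c ->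
  exists2 i, S i & f i < c.
Proof.
move=> S0 fc; apply: contrapT => h; move: fc; rewrite ltNge => /negP; apply.
apply: inf_image_ge => // j Sj; rewrite leNgt; apply/negP => fj.
by apply: h; exists j.
Qed.

Lemma sup_image_ge S f c i : (forall j, S j -> f j <= c) -> S i ->
  f i <= sup (f @` S).
Proof.
move=> ub Si; apply: ub_le_sup; last by exists i.
by exists c => _ [j Sj <-]; exact: ub.
Qed.

Lemma sup_image_le S f c : S !=set0 -> (forall j, S j -> f j <= c) ->
  sup (f @` S) <= c.
Proof.
move=> [i Si] ub; apply: ge_sup; first by exists (f i), i.
by move=> _ [j Sj <-]; exact: ub.
Qed.

Lemma sup_image_gt S f c : S !=set0 -> c < sup (f @` S) ->
  exists2 i, S i & c < f i.
Proof.
move=> S0 fc; apply: contrapT => h; move: fc; rewrite ltNge => /negP; apply.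
apply: sup_image_le => // j Sj; rewrite leNgt; apply/negP => fj.
by apply: h; exists j.
Qed.
End inf_image.

(** * The outer measure of a content *)

Section content_outer_measure.
Context {R : realType} {X : Type} (O : set (set X)) (p : set X -> R).
Hypotheses (hO : is_topology O) (hausO : hausdorff_top O).
Hypotheses (p_ge0 : forall A, 0 <= p A) (p_le1 : forall A, p A <= 1).
Hypothesis p_mono : forall U V, O U -> O V -> U `<=` V -> p U <= p V.
Hypothesis p_setU : forall U V, O U -> O V -> p (U `|` V) <= p U + p V.
Hypothesis p_disj : forall U V, O U -> O V -> U `&` V = set0 ->
  p (U `|` V) = p U + p V.

(** The finitely additive [p] is regularized three times: from outside on compact sets, from inside
    on open sets, and from outside on all sets. This yields countable subadditivity. *)
Definition outer_nbhds (A : set X) : set (set X) := [set U | O U /\ A `<=` U].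

Definition compact_content (K : set X) : R := inf (p @` outer_nbhds K).

Definition inner_compacts (U : set X) : set (set X) :=
  [set K | compact_in O K /\ K `<=` U].

Definition open_content (U : set X) : R :=
  sup (compact_content @` inner_compacts U).

Definition content_outer (A : set X) : R :=
  inf (open_content @` outer_nbhds A).

Local Notation lam := compact_content.
Local Notation nu := open_content.
Local Notation mu := content_outer.

Lemma outer_nbhds_neq0 A : outer_nbhds A !=set0.
Proof. by exists setT; split => //; case: hO. Qed.

Lemma inner_compacts_neq0 U : inner_compacts U !=set0.
Proof. by exists set0; split => //; exact: compact_in_set0. Qed.

Lemma compact_content_le K U : O U -> K `<=` U -> lam K <= p U.
Proof. by move=> oU KU; apply: (@inf_image_le _ _ _ _ 0). Qed.

Lemma compact_content_ge0 K : 0 <= lam K.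
Proof. by apply: inf_image_ge => //; exact: outer_nbhds_neq0. Qed.

Lemma compact_content_le1 K : lam K <= 1.
Proof.
by apply: le_trans (p_le1 setT); apply: compact_content_le => //; case: hO.
Qed.

Lemma compact_content_setU K L : lam (K `|` L) <= lam K + lam L.
Proof.
apply/ler_addgt0Pr => e e0.
have e2 : 0 < e / 2 by rewrite divr_gt0.
have [U [oU KU] pU] : exists2 U, outer_nbhds K U & p U < lam K + e / 2.
  by apply: inf_image_lt; [exact: outer_nbhds_neq0|rewrite ltrDl].
have [V [oV LV] pV] : exists2 U, outer_nbhds L U & p U < lam L + e / 2.
  by apply: inf_image_lt; [exact: outer_nbhds_neq0|rewrite ltrDl].
have : lam (K `|` L) <= p (U `|` V).
  by apply: compact_content_le; [exact: open_setU|exact: setUSS].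
by have := p_setU oU oV; lra.
Qed.

(** Disjoint compact sets have disjoint open neighbourhoods; intersecting these with any open set
    around the union gives two open sets on which [p] is additive. *)
Lemma compact_content_disj K L : compact_in O K -> compact_in O L ->
  K `&` L = set0 -> lam K + lam L <= lam (K `|` L).
Proof.
move=> cK cL KL; apply: inf_image_ge; first exact: outer_nbhds_neq0.
move=> W [oW]; rewrite subUset => -[KW LW].
have [U [V [oU oV KU LV UV]]] := compact_in_sep hO hausO cK cL KL.
have OI : forall U V, O U -> O V -> O (U `&` V) by case: hO.
have : p ((W `&` U) `|` (W `&` V)) <= p W.
  apply: p_mono => //; last by rewrite -setIUr; exact: subIsetl.
  by apply: open_setU => //; exact: OI.
rewrite p_disj; [|exact: OI|exact: OI|by rewrite setIACA UV setI0].
have : lam K <= p (W `&` U).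
  by apply: compact_content_le; [exact: OI|rewrite subsetI].
have : lam L <= p (W `&` V).
  by apply: compact_content_le; [exact: OI|rewrite subsetI].
lra.
Qed.

Lemma open_content_ge U K : compact_in O K -> K `<=` U -> lam K <= nu U.
Proof.
move=> cK KU; apply: (@sup_image_ge _ _ _ _ 1) => // L _.
exact: compact_content_le1.
Qed.

Lemma open_content_ge0 U : 0 <= nu U.
Proof.
apply: le_trans (compact_content_ge0 set0) _.
by apply: open_content_ge => //; exact: compact_in_set0.
Qed.

Lemma open_content_mono U V : U `<=` V -> nu U <= nu V.
Proof.
move=> UV; apply: sup_image_le; first exact: inner_compacts_neq0.
by move=> K [cK KU]; apply: open_content_ge => //; exact: subset_trans UV.
Qed.

Lemma open_content_le U : O U -> nu U <= p U.
Proof.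
move=> oU; apply: sup_image_le; first exact: inner_compacts_neq0.
by move=> K [cK KU]; exact: compact_content_le.
Qed.

Lemma open_content_setU U V : O U -> O V -> nu (U `|` V) <= nu U + nu V.
Proof.
move=> oU oV; apply: sup_image_le; first exact: inner_compacts_neq0.
move=> K [cK KUV].
have [K1 [K2 [cK1 cK2 K1U K2V ->]]] :=
  compact_in_setU_split hO hausO cK oU oV KUV.
by apply: le_trans (compact_content_setU _ _) _; apply: lerD;
  exact: open_content_ge.
Qed.

Lemma open_content_set0 : nu set0 = 0.
Proof.
apply/le_anti; rewrite open_content_ge0 andbT.
have [OT O0 _ _] := hO; apply: le_trans (open_content_le O0) _.
by have := p_disj O0 O0 (setI0 _); rewrite setU0; lra.
Qed.

Lemma open_content_bigsetU n (U : nat -> set X) : (forall i, O (U i)) ->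
  nu (\big[setU/set0]_(i < n) U i) <= \sum_(i < n) nu (U i).
Proof.
move=> oU; elim: n => [|n ih]; first by rewrite !big_ord0 open_content_set0.
rewrite !big_ord_recr/=; apply: le_trans (open_content_setU _ (oU n)) _.
  elim/big_ind : _ => //; [by case: hO|exact: open_setU].
by rewrite lerD2r.
Qed.

Lemma content_outer_le A U : O U -> A `<=` U -> mu A <= nu U.
Proof.
move=> oU AU; apply: (@inf_image_le _ _ _ _ 0) => // V _.
exact: open_content_ge0.
Qed.

Lemma content_outer_ge0 A : 0 <= mu A.
Proof.
apply: inf_image_ge; first exact: outer_nbhds_neq0.
by move=> U _; exact: open_content_ge0.
Qed.

Lemma content_outer_mono A B : A `<=` B -> mu A <= mu B.
Proof.
move=> AB; apply: inf_image_ge; first exact: outer_nbhds_neq0.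
by move=> U [oU BU]; apply: content_outer_le => //; exact: subset_trans BU.
Qed.

Lemma content_outer_open U : O U -> mu U = nu U.
Proof.
move=> oU; apply/le_anti; rewrite content_outer_le//=.
apply: inf_image_ge; first exact: outer_nbhds_neq0.
by move=> V [oV UV]; exact: open_content_mono.
Qed.

Lemma content_outer_compact K : compact_in O K -> lam K <= mu K.
Proof.
move=> cK; apply: inf_image_ge; first exact: outer_nbhds_neq0.
by move=> U [oU KU]; exact: open_content_ge.
Qed.

Lemma content_outer_adherent A e : 0 < e ->
  exists U, [/\ O U, A `<=` U & nu U < mu A + e].
Proof.
move=> e0; have [|U [oU AU] nuU] := @inf_image_lt R _ (outer_nbhds A) nu (mu A + e)
  (outer_nbhds_neq0 A); first by rewrite ltrDl.
by exists U.
Qed.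

(** Each [F i] is enlarged to an open [U i] at a cost of [e / 2 ^ i.+1]. A compact subset of the
    union of the [U i] lies in finitely many of them, which reduces the claim to finite
    subadditivity. *)
Lemma content_outer_sigma_subadditive :
  sigma_subadditive (fun A => (mu A)%:E).
Proof.
move=> F; apply/lee_addgt0Pr => e e0.
have /choice[U hU] i : exists U, [/\ O U, F i `<=` U &
    nu U < mu (F i) + e / (2 ^ i.+1)%:R].
  by apply: content_outer_adherent; rewrite divr_gt0// ltr0n expn_gt0.
have oU i : O (U i) by case: (hU i).
set s := (X in (_ <= X)%E).
have hs n : ((\sum_(i < n) nu (U i))%:E <= s)%E.
  have mu0 i : (0 <= (mu (F i))%:E)%E by rewrite lee_fin content_outer_ge0.
  apply: le_trans (epsilon_trick xpredT mu0 (ltW e0)).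
  rewrite -sumEFin.
  apply: (@le_trans _ _ (\sum_(i < n) ((mu (F i))%:E + (e / (2 ^ i.+1)%:R)%:E))%E).
    by apply: lee_sum => i _; rewrite -EFinD lee_fin ltW//; case: (hU i).
  rewrite -(big_mkord xpredT (fun i => (mu (F i))%:E + (e / (2 ^ i.+1)%:R)%:E)%E).
  apply: nneseries_lim_ge => i _ _.
  by rewrite adde_ge0 ?mu0// lee_fin divr_ge0 ?ler0n// ltW.
have OW : O (\bigcup_i U i) by apply: open_bigcup => // i _.
apply: (@le_trans _ _ (nu (\bigcup_i U i))%:E).
  rewrite lee_fin; apply: content_outer_le => //.
  by apply: subset_bigcup => i _; case: (hU i).
(* The bound is trivial for [+oo], and the empty partial sum excludes [-oo]. *)
case: s hs => [r| |] hs; last 2 first.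
- by rewrite leey.
- by have := hs 0%N; rewrite leeNy_eq.
rewrite lee_fin; apply: sup_image_le; first exact: inner_compacts_neq0.
move=> K [cK KU].
suff [n Kn] : exists n, K `<=` \big[setU/set0]_(i < n) U i.
  apply: le_trans (open_content_ge cK Kn) _.
  by apply: le_trans (open_content_bigsetU _ oU) _; rewrite -lee_fin.
move/(compact_in_idealP O) : cK.
move=> /(_ (fun A => exists n, A `<=` \big[setU/set0]_(i < n) U i)); apply.
  split; first by exists 0%N.
    move=> A B [n An] [m Bm]; exists (maxn n m); rewrite subUset; split.
      by apply: subset_trans An _; apply: subset_bigsetU; rewrite leq_maxl.
    by apply: subset_trans Bm _; apply: subset_bigsetU; rewrite leq_maxr.
  by move=> A B AB [n Bn]; exists n; exact: subset_trans Bn.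
move=> x /KU [i _ Ux]; exists (U i); split => //=.
by exists i.+1; rewrite big_ord_recr; exact: subsetUr.
Qed.

Lemma content_outer_set0 : mu set0 = 0.
Proof. by rewrite content_outer_open ?open_content_set0//; case: hO. Qed.

(* For open W, approximate W `&` U by a compact K inside it, then approximate
   W `\` K (open, since K is closed) by a compact L: K and L are disjoint. *)
Lemma content_outer_split W U : O W -> O U ->
  mu (W `&` U) + mu (W `\` U) <= mu W.
Proof.
move=> oW oU; apply/ler_addgt0Pr => e e0.
have e2 : 0 < e / 2 by rewrite divr_gt0.
have OI : forall U V, O U -> O V -> O (U `&` V) by case: hO.
rewrite (content_outer_open (OI _ _ oW oU)).
have [K [cK KWU] hK] : exists2 K, inner_compacts (W `&` U) K &
    nu (W `&` U) - e / 2 < lam K.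
  by apply: sup_image_gt; [exact: inner_compacts_neq0|rewrite ltrBlDr ltrDl].
have oWK : O (W `\` K) by apply: OI => //; exact: compact_in_open_setC.
have [L [cL LWK] hL] : exists2 L, inner_compacts (W `\` K) L &
    nu (W `\` K) - e / 2 < lam L.
  by apply: sup_image_gt; [exact: inner_compacts_neq0|rewrite ltrBlDr ltrDl].
have : mu (W `\` U) <= nu (W `\` K).
  by apply: content_outer_le => // x [Wx nUx]; split => // /KWU [].
have : lam (K `|` L) <= mu W.
  rewrite content_outer_open//; apply: open_content_ge.
    exact: compact_in_setU.
  by rewrite subUset; split=> [x /KWU []|x /LWK []].
have : lam K + lam L <= lam (K `|` L).
  by apply: compact_content_disj => //; apply/seteqP; split=> // x [Kx /LWK []].
lra.
Qed.

Lemma content_outer_caratheodory U A : O U ->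
  mu (A `&` U) + mu (A `\` U) <= mu A.
Proof.
move=> oU; apply/ler_addgt0Pr => e e0.
have [W [oW AW hW]] := content_outer_adherent A e0.
rewrite -content_outer_open// in hW.
apply: le_trans (ltW hW); apply: le_trans (content_outer_split oW oU).
by apply: lerD; apply: content_outer_mono; [exact: setSI|exact: setSD].
Qed.

(** [f] and its inverse permute the open sets and the compact sets, so each of the three extrema is
    taken over the same set of values. *)
Lemma content_outer_preimage (f : X -> X) A : homeomorphism_in O f ->
  (forall U, O U -> p (f @^-1` U) = p U) -> mu (f @^-1` A) = mu A.
Proof.
move=> hf pf; have [g [fg gf cf cg]] := hf.
have fgE B : f @^-1` (g @^-1` B) = B.
  by apply/seteqP; split => x /=; rewrite fg.
have gfE B : g @^-1` (f @^-1` B) = B.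
  by apply/seteqP; split => x /=; rewrite gf.
have hg : homeomorphism_in O g by exists f.
have lamf K : lam (f @^-1` K) = lam K.
  congr inf; apply/seteqP; split => [_ [U [oU KU] <-]|_ [U [oU KU] <-]].
    exists (g @^-1` U); first split; [exact: cg| |].
      by move=> x Kx; apply: KU; rewrite /= gf.
    by rewrite -pf ?fgE//; exact: cg.
  by exists (f @^-1` U); [split; [exact: cf|move=> x /KU]|rewrite pf].
have nuf U : nu (f @^-1` U) = nu U.
  congr sup; apply/seteqP; split => [_ [K [cK KU] <-]|_ [K [cK KU] <-]].
    exists (g @^-1` K); first split.
    - exact: homeomorphism_in_compact_preimage.
    - by move=> x /= /KU; rewrite /= gf.
    - by rewrite -lamf fgE.
  exists (f @^-1` K); last by rewrite lamf.
  by split; [exact: homeomorphism_in_compact_preimage|move=> x /KU].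
congr inf; apply/seteqP; split => [_ [U [oU AU] <-]|_ [U [oU AU] <-]].
  exists (g @^-1` U); first split; [exact: cg| |].
    by move=> x Ax; apply: AU; rewrite /= gf.
  by rewrite -nuf ?fgE.
by exists (f @^-1` U); [split; [exact: cf|move=> x /AU]|rewrite nuf].
Qed.
End content_outer_measure.

(** * Limits of tight sequences of contents *)

(** Open sets are Carathéodory measurable for the outer measure of [p], so it restricts to a Borel
    measure. Tightness prevents a loss of mass: [m setT] is at least [p K] for every compact [K]. *)
Lemma tight_content_measure (R : realType) (d : measure_display)
    (X : measurableType d) (O : set (set X)) (p : set X -> R) (f : X -> X) :
  is_topology O -> hausdorff_top O -> @measurable d X = <<s O >> ->
  (forall A, 0 <= p A <= 1) -> p setT = 1 ->
  (forall A B, measurable A -> measurable B -> A `&` B = set0 ->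
    p (A `|` B) = p A + p B) ->
  (forall e : R, 0 < e -> exists2 K, compact_in O K & 1 - e <= p K) ->
  homeomorphism_in O f -> (forall U, O U -> p (f @^-1` U) = p U) ->
  exists m : {measure set X -> \bar R}, [/\ m setT = 1%E,
    (forall K, compact_in O K -> ((p K)%:E <= m K)%E) & invariant_measure f m].
Proof.
move=> hO hausO hm p01 pT padd tight hf pf.
have p_ge0 A : 0 <= p A by case/andP: (p01 A).
have p_le1 A : p A <= 1 by case/andP: (p01 A).
have Om A : O A -> measurable A by move=> OA; rewrite hm; exact: sub_sigma_algebra.
have pD A B : measurable A -> measurable B -> A `<=` B -> p B = p A + p (B `\` A).
  move=> mA mB AB; rewrite -padd//; last exact: setDIK.
    by rewrite setDUK.
  exact: measurableD.
have p_mono A B : measurable A -> measurable B -> A `<=` B -> p A <= p B.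
  by move=> mA mB AB; rewrite (pD A B)// lerDl.
have p_setU A B : measurable A -> measurable B -> p (A `|` B) <= p A + p B.
  move=> mA mB; rewrite (pD A (A `|` B))//; last exact: measurableU.
  rewrite lerD2l; apply: p_mono => //.
    by apply: measurableD => //; exact: measurableU.
  by rewrite setDUl setDv set0U; exact: subDsetl.
have cm K : compact_in O K -> measurable K.
  move=> cK; rewrite -[K]setCK; apply: measurableC; apply: Om.
  exact: compact_in_open_setC.
have p_monoO U V : O U -> O V -> U `<=` V -> p U <= p V.
  by move=> oU oV; apply: p_mono; exact: Om.
have p_setUO U V : O U -> O V -> p (U `|` V) <= p U + p V.
  by move=> oU oV; apply: p_setU; exact: Om.
have p_disjO U V : O U -> O V -> U `&` V = set0 -> p (U `|` V) = p U + p V.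
  by move=> oU oV; apply: padd; exact: Om.
pose mu A := (content_outer O p A)%:E.
have mu0 : mu set0 = 0%E by rewrite /mu content_outer_set0.
have mu_ge0 A : (0 <= mu A)%E by rewrite lee_fin; exact: content_outer_ge0.
have mu_mono : {homo mu : A B / A `<=` B >-> (A <= B)%E}.
  by move=> A B AB; rewrite lee_fin; exact: content_outer_mono.
have mu_sub : sigma_subadditive mu by exact: content_outer_sigma_subadditive.
pose om : {outer_measure set X -> \bar R} := HB.pack mu
  (isOuterMeasure.Build R X mu mu0 mu_ge0 mu_mono mu_sub).
have mcara A : measurable A -> om.-caratheodory A.
  rewrite hm; move: A; apply: smallest_sub.
    split; first exact: caratheodory_measurable_set0.
      by move=> A; rewrite setTD; exact: caratheodory_measurable_setC.
    exact: caratheodory_measurable_bigcup.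
  move=> U oU; apply: le_caratheodory_measurable => A.
  by rewrite -EFinD lee_fin -setDE; exact: content_outer_caratheodory.
have mu_sigma : semi_sigma_additive (mu : set X -> \bar R).
  move=> F mF tF mUF.
  apply: (@caratheodory_measure_sigma_additive _ _ om) => //.
    by move=> i; exact: mcara.
  exact: mcara.
pose m : {measure set X -> \bar R} := HB.pack mu
  (isMeasure.Build d X R mu mu0 mu_ge0 mu_sigma).
have pK K : compact_in O K -> ((p K)%:E <= m K)%E.
  move=> cK; rewrite lee_fin.
  apply: le_trans (content_outer_compact hO p_ge0 p_le1 cK).
  apply: inf_image_ge; first exact: outer_nbhds_neq0.
  by move=> U [oU KU]; apply: p_mono => //; [exact: cm|exact: Om].
exists m; split => //.
  apply/eqP; rewrite eq_le; apply/andP; split; rewrite lee_fin.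
    by rewrite content_outer_open// -?pT; [apply: open_content_le => //|];
      case: hO.
  apply/ler_addgt0Pr => e e0; have [K cK pKe] := tight e e0.
  rewrite -lerBlDr; apply: le_trans pKe _; rewrite -lee_fin.
  by apply: le_trans (pK K cK) _; rewrite lee_fin; exact: content_outer_mono.
by move=> A _; congr EFin; exact: content_outer_preimage.
Qed.

(** Compactness of the segment gives a cluster point, and an ultrafilter converges to each of its
    cluster points. *)
Lemma ultrafilter_cvg_segment (R : realType) (I : Type) (G : set_system I)
    (u : I -> R) (a b : R) : UltraFilter G -> (forall i, a <= u i <= b) ->
  exists2 l, a <= l <= b & u @ G --> l.
Proof.
move=> UG uab; have PG : ProperFilter G := @ultra_proper _ _ UG.
have : compact `[a, b] by exact: segment_compact.
move=> /(_ (u @ G)) [|l [abl cl]].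
  by apply: (@filterE _ G) => i /=; rewrite in_itv /= uab.
exists l; first by move: abl; rewrite /= in_itv.
move=> A Al; have [//|GnA] := in_ultra_setVsetC (u @^-1` A) UG.
by have [x [nAx Ax]] := cl (~` A) A GnA Al.
Qed.

Section tight_limit.
Context (R : realType) (d : measure_display) (X : measurableType d).
Context (O : set (set X)) (u : nat -> set X -> R) (f : X -> X).
Hypotheses (hO : is_topology O) (hausO : hausdorff_top O).
Hypothesis hm : @measurable d X = <<s O >>.
Hypothesis hf : homeomorphism_in O f.
Hypothesis u01 : forall n A, measurable A -> 0 <= u n A <= 1.
Hypothesis uT : \forall n \near \oo, u n setT = 1.
Hypothesis uadd : forall n A B, measurable A -> measurable B ->
  A `&` B = set0 -> u n (A `|` B) = u n A + u n B.
Hypothesis uf : forall U, O U -> (fun n => u n (f @^-1` U) - u n U) @ \oo --> 0.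
Hypothesis utight : forall e : R, 0 < e ->
  exists2 K, compact_in O K & \forall n \near \oo, 1 - e <= u n K.

(** One ultrafilter finer than [\oo] gives limits on all measurable sets at once, so that finite
    additivity passes to [p]. *)
Lemma tight_limit_measure :
  exists (G : set_system nat) (p : set X -> R) (m : {measure set X -> \bar R}),
  [/\ ProperFilter G, \oo `<=` G, (forall A, measurable A -> u ^~ A @ G --> p A),
    m setT = 1%E /\ invariant_measure f m &
    (forall K, compact_in O K -> ((p K)%:E <= m K)%E)].
Proof.
have [G [UG ooG]] := @ultraFilterLemma nat \oo _.
have PG : ProperFilter G := @ultra_proper _ _ UG.
have Om A : O A -> measurable A by move=> OA; rewrite hm; exact: sub_sigma_algebra.
have cm K : compact_in O K -> measurable K.
  move=> cK; rewrite -[K]setCK; apply: measurableC; apply: Om.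
  exact: compact_in_open_setC.
(* Nonmeasurable sets get the default value 0, which keeps [p] between 0 and 1 everywhere. *)
have /choice[p hp] A : exists l : R, 0 <= l <= 1 /\
    (measurable A -> u ^~ A @ G --> l).
  have [mA|nmA] := pselect (measurable A); last first.
    by exists 0; split => //; rewrite lexx ler01.
  have [|l l01 ul] := @ultrafilter_cvg_segment R nat G (u ^~ A) 0 1 UG.
    by move=> n; exact: u01.
  by exists l; split => // _.
have up A : measurable A -> u ^~ A @ G --> p A by case: (hp A).
have cvgG (v : nat -> R) (l : R) : v @ \oo --> l -> v @ G --> l.
  by move=> vl B /vl; exact: ooG.
have [|||||m [mT pm mf]] :=
  @tight_content_measure R d X O p f hO hausO hm (fun A => (hp A).1).
- apply: (cvg_unique (@Rhausdorff R) (up _ measurableT)).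
  apply: cvgG; apply: cvg_near_cst; exact: uT.
- move=> A B mA mB AB.
  apply: (cvg_unique (@Rhausdorff R) (up _ (measurableU _ _ mA mB))).
  have -> : u ^~ (A `|` B) = (fun n => u n A + u n B).
    by apply/funext => n; exact: uadd.
  by apply: (cvgD); exact: up.
- move=> e e0; have [K cK uK] := utight e0; exists K => //.
  apply: (cvgr_to_ge (up K (cm K cK))); exact: ooG.
- exact: hf.
- move=> U oU; have mfU : measurable (f @^-1` U).
    by apply: Om; case: hf => g [_ _ cf _]; exact: cf.
  apply/eqP; rewrite -subr_eq0; apply/eqP.
  have h : (fun n => u n (f @^-1` U) - u n U) @ G --> p (f @^-1` U) - p U.
    by apply: cvgB; apply: up => //; exact: Om.
  exact: (cvg_unique (@Rhausdorff R) h (cvgG _ _ (uf oU))).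
by exists G, p, m; split.
Qed.
End tight_limit.

(** * Ergodic measures by minimization *)

Section unit_mass.
Context (R : realType) (d : measure_display) (X : measurableType d).
Implicit Types (m : {measure set X -> \bar R}) (A B : set X).

Lemma unit_mass_fineK m A : m setT = 1%E -> measurable A ->
  (fine (m A))%:E = m A.
Proof.
move=> mT mA; apply: fineK; rewrite ge0_fin_numE//.
by apply: (@le_lt_trans _ _ (m setT)); [rewrite le_measure ?inE|rewrite mT ltry].
Qed.

Lemma unit_mass_le1 m A : m setT = 1%E -> measurable A -> 0 <= fine (m A) <= 1.
Proof.
move=> mT mA; rewrite -!lee_fin unit_mass_fineK// measure_ge0/= -mT.
by rewrite le_measure ?inE.
Qed.

Lemma unit_mass_setU m A B : m setT = 1%E -> measurable A -> measurable B ->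
  A `&` B = set0 -> fine (m (A `|` B)) = fine (m A) + fine (m B).
Proof.
move=> mT mA mB AB; apply: EFin_inj.
rewrite EFinD !unit_mass_fineK//; last exact: measurableU.
exact: measureU.
Qed.

Lemma unit_mass_split m A B : m setT = 1%E -> measurable A -> measurable B ->
  fine (m A) = fine (m (A `&` B)) + fine (m (A `&` ~` B)).
Proof.
move=> mT mA mB; rewrite -unit_mass_setU//.
- by rewrite -setIUr setUv setIT.
- exact: measurableI.
- by apply: measurableI => //; exact: measurableC.
- by rewrite setIACA setICr setI0.
Qed.

Lemma unit_mass_setC m A : m setT = 1%E -> measurable A ->
  fine (m (~` A)) = 1 - fine (m A).
Proof.
move=> mT mA; have := unit_mass_split mT measurableT mA.
by rewrite !setTI mT /= => ->; rewrite addrAC subrr add0r.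
Qed.

(** Conditioning on a strictly invariant set preserves invariance. Applied to a set and its
    complement, it writes [m] as a convex combination of invariant measures. *)
Lemma conditional_invariant_measure m (f : X -> X) A : m setT = 1%E ->
  invariant_measure f m -> measurable A -> f @^-1` A = A -> 0 < fine (m A) ->
  exists m' : {measure set X -> \bar R}, [/\ m' setT = 1%E,
    invariant_measure f m' & forall B, measurable B ->
    fine (m' B) = fine (m (B `&` A)) / fine (m A)].
Proof.
move=> mT mf mA fA A0.
have t0 : 0 <= (fine (m A))^-1 by rewrite invr_ge0 ltW.
pose m' : {measure set X -> \bar R} := mscale (NngNum t0) (mrestr m mA).
have m'E B : measurable B -> m' B = (fine (m (B `&` A)) / fine (m A))%:E.
  move=> mB; rewrite mulrC EFinM unit_mass_fineK//; exact: measurableI.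
exists m'; split.
- by rewrite m'E// setTI divff// gt_eqF.
- move=> B mB; rewrite /m' /= /mscale /= /mrestr; congr (_ * _)%E.
  by rewrite -[in LHS]fA -preimage_setI mf//; exact: measurableI.
- by move=> B mB; rewrite m'E.
Qed.
End unit_mass.

Section unit_mass_probability.
Context (R : realType) (d : measure_display) (X : measurableType d).
Variable m : {measure set X -> \bar R}.
Hypothesis mT : m setT = 1%E.

(** A named copy of [m], to which the probability structure given by [mT] is attached. *)
Definition unit_mass_probability (A : set X) : \bar R := m A.

HB.instance Definition _ := isMeasure.Build d X R unit_mass_probability
  (measure0 m) (measure_ge0 m) (@measure_semi_sigma_additive _ _ _ m).

HB.instance Definition _ := Measure_isProbability.Build d X R
  unit_mass_probability mT.

Lemma exists_unit_mass_probability : exists P : probability X R, P = m :> (set X -> \bar R).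
Proof. by exists unit_mass_probability. Qed.
End unit_mass_probability.

(** * Minimizing a penalty over the invariant measures *)

Section ergodic_minimizer.
Context (R : realType) (d : measure_display) (X : measurableType d).
Context (O : set (set X)) (f : X -> X) (C K : nat -> set X).
Hypotheses (hO : is_topology O) (hausO : hausdorff_top O).
Hypothesis hm : @measurable d X = <<s O >>.
Hypothesis hf : homeomorphism_in O f.
Hypotheses (cC : forall i, compact_in O (C i)) (cK : forall i, compact_in O (K i)).
Hypotheses (KI : setI_closed (range K)) (Kcover : \bigcup_i K i = setT).
Hypothesis Kgen : @measurable d X = <<s range K >>.

Implicit Types (m : {measure set X -> \bar R}).

Definition invariant_unit (m : {measure set X -> \bar R}) : Prop :=
  m setT = 1%E /\ invariant_measure f m.

(* The first summand forces tightness; the second is strictly concave in the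
   values m (K i), which makes the minimizers extreme, hence ergodic. *)
Definition penalty (p : set X -> R) (i : nat) : R :=
  8 * 2 ^+ i * (1 - p (C i)) + (1 - p (K i) ^+ 2) / 2 ^+ i.

(** Terms are nonnegative for unit masses, so a bound on the infinite sum is expressed as a bound on
    all partial sums, and no infinite values occur. *)
Definition total_penalty (p : set X -> R) (n : nat) : R :=
  \sum_(i < n) penalty p i.

Let r (m : {measure set X -> \bar R}) (A : set X) : R := fine (m A).

Let cm A : compact_in O A -> measurable A.
Proof.
move=> cA; rewrite -[A]setCK; apply: measurableC; rewrite hm.
by apply: sub_sigma_algebra; exact: compact_in_open_setC.
Qed.

Let two_gt0 i : 0 < 2 ^+ i :> R.
Proof. by rewrite exprn_gt0. Qed.

(** Needed for limits: the limit measure is only known to dominate the limit content on compact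
    sets. *)
Lemma penalty_mono (p q : set X -> R) i : p (C i) <= q (C i) ->
  0 <= p (K i) <= q (K i) -> penalty q i <= penalty p i.
Proof.
move=> hC /andP[hK0 hK]; apply: lerD.
  by apply: ler_wpM2l; [rewrite mulr_ge0// ltW|exact: lerB].
apply: ler_wpM2r; first by rewrite invr_ge0 ltW.
by apply: lerB => //; rewrite lerXn2r// nnegrE//; exact: le_trans hK.
Qed.

Lemma penalty_ge m i : m setT = 1%E -> 8 * 2 ^+ i * (1 - r m (C i)) <= penalty (r m) i.
Proof.
move=> mT; rewrite lerDl; apply: divr_ge0; last exact: ltW.
rewrite subr_ge0; have /andP[k0 k1] := unit_mass_le1 mT (cm (@cK i)).
by rewrite expr_le1.
Qed.

Lemma penalty_ge0 m i : m setT = 1%E -> 0 <= penalty (r m) i.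
Proof.
move=> mT; apply: le_trans (penalty_ge i mT).
have /andP[k0 k1] := unit_mass_le1 mT (cm (@cC i)).
by apply: mulr_ge0; [apply: mulr_ge0 => //; exact: ltW|rewrite subr_ge0].
Qed.

Lemma total_penalty_mono m n k : m setT = 1%E -> (n <= k)%N ->
  total_penalty (r m) n <= total_penalty (r m) k.
Proof.
move=> mT; elim: k => [|k ih]; first by rewrite leqn0 => /eqP ->.
rewrite leq_eqVlt => /orP[/eqP ->//|]; rewrite ltnS => /ih /le_trans; apply.
by rewrite /total_penalty big_ord_recr/= lerDl penalty_ge0.
Qed.

Lemma penalty_le_total m n i : m setT = 1%E -> (i < n)%N ->
  penalty (r m) i <= total_penalty (r m) n.
Proof.
move=> mT ik; apply: le_trans (total_penalty_mono mT ik).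
rewrite /total_penalty big_ord_recr/= lerDr sumr_ge0// => j _.
exact: penalty_ge0.
Qed.

(** The first summand of the penalty is affine; the square contributes the variance of a two-point
    distribution. *)
Lemma penalty_convex (p q1 q2 : set X -> R) t i :
  p (C i) = t * q1 (C i) + (1 - t) * q2 (C i) ->
  p (K i) = t * q1 (K i) + (1 - t) * q2 (K i) ->
  penalty p i = t * penalty q1 i + (1 - t) * penalty q2 i +
    t * (1 - t) * (q1 (K i) - q2 (K i)) ^+ 2 / 2 ^+ i.
Proof.
move=> hC hK; rewrite /penalty hK hC; field.
by rewrite gt_eqF.
Qed.

(** Its infimum [c] is the least infinite penalty; measures of infinite penalty contribute no
    bound. *)
Let bounds : set R :=
  [set c | exists2 m, invariant_unit m & forall n, total_penalty (r m) n <= c].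

Let bounds_ge0 c : bounds c -> 0 <= c.
Proof.
by move=> [m _ /(_ 0%N)]; rewrite /total_penalty big_ord0.
Qed.

Variable m0 : {measure set X -> \bar R}.
Hypothesis m0_unit : invariant_unit m0.
Hypothesis m0C : forall i, 1 - fine (m0 (C i)) <= (8 * 4 ^+ i)^-1.

(** By [m0C] each summand of the [i]-th penalty is at most [1 / 2 ^+ i], and the sum of [2 / 2 ^+ i]
    over [i < n] is [4 - 4 / 2 ^+ n]. *)
Let bounds4 : bounds 4.
Proof.
have [mT _] := m0_unit; exists m0 => // n.
suff : total_penalty (r m0) n <= 4 - 4 / 2 ^+ n.
  by move/le_trans; apply; rewrite lerBlDr lerDl; apply: divr_ge0 => //; exact: ltW.
elim: n => [|n ih]; first by rewrite /total_penalty big_ord0 expr0; lra.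
rewrite /total_penalty big_ord_recr/=.
have -> : 4 - 4 / 2 ^+ n.+1 = (4 - 4 / 2 ^+ n) + 2 / 2 ^+ n :> R.
  by rewrite exprS; field; rewrite gt_eqF.
apply: lerD => //; rewrite /penalty.
have -> : 2 / 2 ^+ n = 8 * 2 ^+ n * (8 * 4 ^+ n)^-1 + 1 / 2 ^+ n :> R.
  have -> : 4 ^+ n = 2 ^+ n * 2 ^+ n :> R by rewrite -exprMn -natrM.
  by field; rewrite gt_eqF.
apply: lerD.
  by apply: ler_wpM2l => //; exact: m0C.
by apply: ler_wpM2r; [rewrite invr_ge0 ltW|rewrite gerBl sqr_ge0].
Qed.

Let c := inf bounds.

Let c_le b : bounds b -> c <= b.
Proof. by move=> bb; apply: ge_inf => //; exists 0 => x /bounds_ge0. Qed.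

Let c_approx m (e : R) : invariant_unit m -> 0 < e -> exists n, c - e < total_penalty (r m) n.
Proof.
move=> hu e0; apply: contrapT => h.
have : c <= c - e.
  by apply: c_le; exists m => // n; rewrite leNgt; apply/negP => hn; apply: h; exists n.
by rewrite lerBrDl gerDr leNgt e0.
Qed.

(** Direct method: a minimizing sequence is tight, its limit content [p] has penalty at most [c],
    and passing from [p] to the measure [m] can only lower the penalty. *)
Lemma exists_penalty_minimizer :
  exists2 m, invariant_unit m & forall n, total_penalty (r m) n <= c.
Proof.
have /choice[ms hms] k : exists m, invariant_unit m /\
    forall n, total_penalty (r m) n <= c + k.+1%:R^-1.
  have [] := @inf_adherent _ bounds k.+1%:R^-1.
  - by rewrite invr_gt0.
  - by split; [exists 4|exists 0 => x /bounds_ge0].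
  by move=> b [m hu hb] /ltW bc; exists m; split => // n; exact: le_trans bc.
have mT k : ms k setT = 1%E by case: (hms k) => -[].
have [|||||G [p [m [PG ooG up [mT' mf] pm]]]] :=
  @tight_limit_measure R d X O (fun k => r (ms k)) f hO hausO hm hf.
- by move=> k A; exact: unit_mass_le1.
- by near=> k; rewrite /r mT.
- by move=> k A B; exact: unit_mass_setU.
- move=> U oU; rewrite (_ : (fun _ => _) = cst 0); first exact: cvg_cst.
  apply/funext => k; have [[_ mfk] _] := hms k.
  have mU : measurable U by rewrite hm; exact: sub_sigma_algebra.
  by rewrite /r mfk// subrr.
- move=> e e0.
  (* All penalties in the sequence are at most [4 + 1 = 5], so the mass outside [C i] is at most
     [5 / (8 * 2 ^+ i)]. *)
  have [i hi] : exists i, 5 / (8 * e) < 2 ^+ i.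
    exists (Num.bound (5 / (8 * e))).
    apply: lt_trans (archi_boundP _) _.
      by rewrite divr_ge0// mulr_ge0// ltW.
    by rewrite -natrX ltr_nat ltn_expl.
  exists (C i); first exact: cC.
  near=> k; rewrite lerBlDr -lerBlDl.
  have := le_trans (penalty_ge i (mT k)) (penalty_le_total (mT k) (ltnSn i)).
  have h : c + k.+1%:R^-1 <= 5.
    have : k.+1%:R^-1 <= 1 :> R by rewrite invf_le1 ?ler1n.
    by have := c_le bounds4; move: c k.+1%:R^-1 => x y; lra.
  have h8 := (hms k).2 i.+1.
  move: hi; rewrite ltr_pdivrMr ?mulr_gt0// => hi h1.
  suff : 8 * 2 ^+ i * (1 - r (ms k) (C i)) <= 8 * 2 ^+ i * e.
    by rewrite ler_pM2l// mulr_gt0.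
  apply: le_trans h1 (le_trans h8 (le_trans h _)); rewrite ltW//.
  by rewrite (mulrC 8) -mulrA.
exists m => // n.
apply/ler_addgt0Pr => e e0.
have pen_cvg i : (fun k => penalty (r (ms k)) i) @ G --> penalty p i.
  have hC := up _ (cm (@cC i)); have hK := up _ (cm (@cK i)).
  apply: cvgD.
    by apply: cvgMr; apply: cvgB => //; exact: cvg_cst.
  apply: cvgMl; apply: cvgB; first exact: cvg_cst.
  by rewrite expr2; under eq_fun do rewrite expr2; exact: cvgM.
have tot_cvg : (fun k => total_penalty (r (ms k)) n) @ G --> total_penalty p n.
  rewrite /total_penalty; elim: (n) => [|j ih].
    by rewrite big_ord0; under eq_fun do rewrite big_ord0; exact: cvg_cst.
  rewrite big_ord_recr/=; under eq_fun do rewrite big_ord_recr/=.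
  exact: cvgD.
have : total_penalty (r m) n <= total_penalty p n.
  apply: ler_sum => i _; apply: penalty_mono.
    by rewrite -lee_fin unit_mass_fineK//; [exact: pm|exact: cm].
  apply/andP; split.
    apply: (cvgr_to_ge (up _ (cm (@cK i)))); near=> k.
    by case/andP: (unit_mass_le1 (mT k) (cm (@cK i))).
  by rewrite -lee_fin unit_mass_fineK//; [exact: pm|exact: cm].
move/le_trans; apply.
apply: (cvgr_to_le tot_cvg); apply: ooG.
near=> k; apply: le_trans ((hms k).2 n) _; rewrite lerD2l ltW//.
near: k; exact: (near_infty_natSinv_lt (PosNum e0)).
Unshelve. all: by end_near. Qed.

(** If [A] had intermediate mass, conditioning on [A] and on its complement would split [m] into
    [m1] and [m2]. Minimality makes them agree on the pi-system of the [K i], hence everywhere,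
    although [A] has mass 1 for one and 0 for the other. *)
Lemma penalty_minimizer_ergodic m A : invariant_unit m ->
  (forall n, total_penalty (r m) n <= c) -> measurable A -> f @^-1` A = A ->
  m A = 0%E \/ m A = 1%E.
Proof.
move=> hu mc mA fA; have [mT mf] := hu.
have mCA : measurable (~` A) by exact: measurableC.
have /andP[A0 A1] := unit_mass_le1 mT mA.
have [A0e|A0'] := eqVneq (r m A) 0.
  by left; rewrite -(unit_mass_fineK mT mA) -/(r m A) A0e.
have [A1e|A1'] := eqVneq (r m A) 1.
  by right; rewrite -(unit_mass_fineK mT mA) -/(r m A) A1e.
exfalso.
set t := r m A in A0' A1'; rewrite -/(r m A) -/t in A0 A1.
have t0 : 0 < t by rewrite lt0r A0'.
have t1 : 0 < 1 - t by rewrite subr_gt0 lt_neqAle A1'.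
have tC : r m (~` A) = 1 - t by exact: unit_mass_setC.
have [m1 [m1T m1f m1E]] := conditional_invariant_measure mT mf mA fA t0.
have fCA : f @^-1` (~` A) = ~` A by rewrite -preimage_setC fA.
have [|m2 [m2T m2f m2E]] := conditional_invariant_measure mT mf mCA fCA.
  by rewrite -/(r m (~` A)) tC.
have mE B : measurable B -> r m B = t * r m1 B + (1 - t) * r m2 B.
  move=> mB; rewrite /r m1E// m2E// -/(r m A) -/(r m (~` A)) tC -/t.
  rewrite mulrCA divff// mulr1 mulrCA divff ?mulr1 ?gt_eqF//.
  exact: unit_mass_split.
have K12 i : r m1 (K i) = r m2 (K i).
  apply/eqP; rewrite -subr_eq0; apply/negPn/negP => Ki.
  (* This is the convexity gap at index [i]. Once both partial sums exceed [c - e / 2], that of [m]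
     exceeds [c + e / 2], a contradiction. *)
  set e := t * (1 - t) * (r m1 (K i) - r m2 (K i)) ^+ 2 / 2 ^+ i.
  have e0 : 0 < e.
    apply: divr_gt0 => //; apply: mulr_gt0; first exact: mulr_gt0.
    by rewrite exprn_even_gt0.
  have e2 : 0 < e / 2 by rewrite divr_gt0.
  have [n1 hn1] := c_approx (conj m1T m1f) e2.
  have [n2 hn2] := c_approx (conj m2T m2f) e2.
  set n := maxn i.+1 (maxn n1 n2).
  have {}hn1 : c - e / 2 < total_penalty (r m1) n.
    apply: lt_le_trans hn1 _; apply: total_penalty_mono => //.
    by rewrite /n !leq_max leqnn orbT.
  have {}hn2 : c - e / 2 < total_penalty (r m2) n.
    apply: lt_le_trans hn2 _; apply: total_penalty_mono => //.
    by rewrite /n !leq_max leqnn !orbT.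
  have i_n : (i < n)%N by rewrite /n leq_max leqnn.
  have : t * total_penalty (r m1) n + (1 - t) * total_penalty (r m2) n + e <=
      total_penalty (r m) n.
    rewrite [leRHS]/total_penalty (eq_bigr (fun j : 'I_n => t * penalty (r m1) j +
        (1 - t) * penalty (r m2) j +
        t * (1 - t) * (r m1 (K j) - r m2 (K j)) ^+ 2 / 2 ^+ j)); last first.
      by move=> j _; apply: penalty_convex; apply: mE; exact: cm.
    rewrite 2!big_split/= -!mulr_sumr lerD2l (bigD1 (Ordinal i_n))//=.
    rewrite lerDl sumr_ge0// => j _; apply: divr_ge0; last exact: ltW.
    by apply: mulr_ge0; [apply: mulr_ge0; exact: ltW|exact: sqr_ge0].
  move/le_trans => /(_ _ (mc n)).
  have : t * (c - e / 2) < t * total_penalty (r m1) n by rewrite ltr_pM2l.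
  have : (1 - t) * (c - e / 2) < (1 - t) * total_penalty (r m2) n by rewrite ltr_pM2l.
  move: (total_penalty _ _) (total_penalty _ _) e0 => x y.
  clear e2 hn1 hn2; move: c e => c' e'; lra.
have := @measure_unique d R X (range K) K Kgen KI _ Kcover m1 m2 _ _ A mA.
have -> : m1 A = 1%E.
  rewrite -(unit_mass_fineK m1T)// m1E// setIid divff//.
have -> : m2 A = 0%E.
  by rewrite -(unit_mass_fineK m2T)// m2E// setICr measure0/= mul0r.
move=> h; suff : (1 : \bar R)%E = 0%E by move/eqP; rewrite onee_eq0.
apply: h => [i|_ [i _ <-]|i]; first by exists i.
  have mK : measurable (K i) by exact: cm.
  by rewrite -(unit_mass_fineK m1T)// -(unit_mass_fineK m2T)// -/(r m1 _) K12.
have mK : measurable (K i) by exact: cm.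
by rewrite -(unit_mass_fineK m1T)// ltry.
Qed.

(** If the minimizer vanished on [C i], its penalty would be at least [8 * 2 ^+ i], hence above the
    bound 4. *)
Lemma exists_ergodic_charging :
  exists m : probability X R, ergodic_measure f m /\ forall i, (0 < m (C i))%E.
Proof.
have [m [mT mf] mc] := exists_penalty_minimizer.
have [P PE] := exists_unit_mass_probability mT.
exists P; rewrite /ergodic_measure PE; split.
  by split=> // A mA fA; exact: penalty_minimizer_ergodic.
move=> i; rewrite lt0e measure_ge0 andbT; apply/eqP => mC0.
have := le_trans (penalty_ge i mT) (penalty_le_total mT (ltnSn i)).
move/le_trans => /(_ _ (mc i.+1)) /le_trans /(_ (c_le bounds4)).
rewrite /r [m (C i)]mC0 /= subr0 mulr1 => h.
have : 8 * 1 <= 8 * 2 ^+ i :> R by rewrite ler_pM2l// exprn_ege1// ler1n.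
move: h; move: (2 ^+ i) => x; lra.
Qed.

End ergodic_minimizer.

(** * Countable bases and empirical measures *)

(** A countable network: its members need not be open, so compact sets can serve. *)
Definition countable_net {X : Type} (O : set (set X)) (B : nat -> set X) : Prop :=
  forall U x, O U -> U x -> exists i, B i x /\ B i `<=` U.

Lemma polish_countable_base (R : realType) (X : pointedType) (O : set (set X)) :
  polish_top R O -> exists B : nat -> set X,
  [/\ forall i, O (B i), forall i, B i !=set0 & countable_net O B].
Proof.
move=> [dist [[d0 d0E] [dC dtri] dO _ [D [Dcount Ddense]]]].
have ballO x (e : R) : O [set y | dist x y < e].
  apply/dO => y /= xy; exists (e - dist x y); first by rewrite subr_gt0.
  by move=> z /=; rewrite ltrBrDl; exact: le_lt_trans.
have dxx x : dist x x = 0 by exact/d0E.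
have /pcard_surjP[q qD] := Dcount.
pose B i := let ak := odflt (0%N, 0%N) (unpickle i) in
  [set y | dist (q ak.1) y < ak.2.+1%:R^-1].
exists B; split.
- by move=> i; exact: ballO.
- by move=> i; exists (q (odflt (0%N, 0%N) (unpickle i)).1); rewrite /B /= dxx invr_gt0.
move=> U x oU Ux; have [e e0 eU] := (dO U).1 oU x Ux.
(* The centre [q a] lies within [k.+1%:R^-1] of [x], so its ball of that radius stays within
   [2 / k.+1%:R < e] of [x]. *)
have [k ke] : exists k : nat, 2 / e < k.+1%:R.
  exists (Num.bound (2 / e)); apply: lt_trans (archi_boundP _) _.
    by rewrite divr_ge0// ltW.
  by rewrite ltr_nat.
have [|y [Dy xy]] := Ddense [set y | dist x y < k.+1%:R^-1] (ballO _ _).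
  by exists x; rewrite /= dxx invr_gt0.
have [a _ qa] := qD y Dy.
exists (pickle (a, k)); rewrite /B pickleK /= qa dC; split=> // z yz.
apply: eU => /=; apply: le_lt_trans (dtri x y z) _.
have : 2 / k.+1%:R < e by rewrite ltr_pdivrMr// mulrC -ltr_pdivrMr.
by move: xy yz => /=; move: (k.+1%:R^-1) => w; lra.
Qed.

(** For each pair of basic sets with a compact set in between, one such set is chosen; finite
    intersections of these are still countable in number. *)
Lemma countable_compact_net (X : Type) (O tau : set (set X)) (B : nat -> set X) :
  is_topology tau -> hausdorff_top tau -> compact_nbhs_basis O tau ->
  (forall i, O (B i)) -> countable_net O B ->
  exists K : nat -> set X, [/\ forall i, compact_in tau (K i),
    setI_closed (range K) & countable_net O K].
Proof.
move=> htau haus hb oB netB.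
have /choice[F hF] (nm : nat * nat) : exists K, compact_in tau K /\
    ((exists K', [/\ compact_in tau K', B nm.1 `<=` K' & K' `<=` B nm.2]) ->
     B nm.1 `<=` K /\ K `<=` B nm.2).
  have [[K' [cK' BK KB]]|h] := pselect
      (exists K', [/\ compact_in tau K', B nm.1 `<=` K' & K' `<=` B nm.2]).
    by exists K'.
  by exists set0; split => //; exact: compact_in_set0.
pose FI (s : seq (nat * nat)) := foldr (fun b A => F b `&` A) setT s.
(* The empty intersection [setT] may fail to be compact, so the empty list is sent to [set0]. *)
pose Kf s := if s is [::] then set0 else FI s.
have cFI a s : compact_in tau (F a `&` FI s).
  elim: s a => [a|b s ih a] /=; first by rewrite setIT; case: (hF a).
  by apply: compact_in_setI => //; case: (hF a).
have FI_cat s t : FI (s ++ t) = FI s `&` FI t.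
  by elim: s => [|a s ih] /=; rewrite ?setTI// ih setIA.
exists (fun i => Kf (odflt [::] (unpickle i))); split.
- move=> i; case: (odflt _ _) => [|a s]; first exact: compact_in_set0.
  exact: cFI.
- have inK s : (range (fun i => Kf (odflt [::] (unpickle i)))) (Kf s).
    by exists (pickle s) => //; rewrite pickleK.
  move=> _ _ [i _ <-] [j _ <-].
  case: (odflt _ (unpickle i)) => [|a s]; first by rewrite set0I; exact: (inK [::]).
  case: (odflt _ (unpickle j)) => [|b t]; first by rewrite setI0; exact: (inK [::]).
  by have := inK ((a :: s) ++ (b :: t)); rewrite /Kf FI_cat.
move=> U x oU Ux; have [m [Bmx BmU]] := netB U x oU Ux.
have [K [[W [oW Wx WK]] KB cK]] := hb x (B m) (oB m) Bmx.
have [n [Bnx BnW]] := netB W x oW Wx.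
have [] := (hF (n, m)).2; first by exists K; split => // y /BnW /WK.
move=> BF FB; exists (pickle [:: (n, m)]); rewrite pickleK /= setIT.
split; first by split => //; exact: BF.
by move=> y /FB /BmU.
Qed.

Lemma countable_net_sigma (X : Type) (O : set (set X)) (K : nat -> set X) :
  countable_net O K -> O `<=` <<s range K >>.
Proof.
move=> netK U oU.
have -> : U = \bigcup_i (if `[< K i `<=` U >] then K i else set0).
  apply/seteqP; split => [x Ux|x [i _]].
    by have [i [Kx KU]] := netK U x oU Ux; exists i => //; rewrite asboolT.
  by case: asboolP => // KU /KU.
apply: sigma_algebra_bigcup => i; case: asboolP => _; last exact: sigma_algebra0.
by apply: sub_sigma_algebra; exists i.
Qed.

Lemma sigma_algebra_sub_gen (X : Type) (G H : set (set X)) :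
  G `<=` <<s H >> -> <<s G >> `<=` <<s H >>.
Proof. by apply: smallest_sub; exact: smallest_sigma_algebra. Qed.

Lemma compact_in_sigma (X : Type) (O : set (set X)) (K : set X) :
  is_topology O -> hausdorff_top O -> compact_in O K -> <<s O >> K.
Proof.
move=> hO haus cK; rewrite -[K]setCK -setTD; apply: sigma_algebraCD.
by apply: sub_sigma_algebra; exact: compact_in_open_setC.
Qed.

Lemma continuous_in_measurable (d : measure_display) (X : measurableType d)
    (O : set (set X)) (f : X -> X) (A : set X) : @measurable d X = <<s O >> ->
  continuous_in O f -> measurable A -> measurable (f @^-1` A).
Proof.
move=> hm cf; rewrite [X in X A -> _]hm; move: A; apply: smallest_sub.
  split => [|A mA|F mF].
  - by rewrite preimage_set0.
  - by rewrite setTD preimage_setC; exact: measurableC.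
  - by rewrite preimage_bigcup; exact: bigcup_measurable.
by move=> U oU; rewrite hm; apply: sub_sigma_algebra; exact: cf.
Qed.

Lemma limn_einf_gt_near (R : realType) (u : nat -> \bar R) a :
  (a < limn_einf u)%E -> \forall n \near \oo, (a < u n)%E.
Proof.
rewrite limn_einf_lim (cvg_lim _ (@cvg_einfs_sup R u))// => /ereal_sup_gt[_ [N _ <-] aN].
exists N => // n /= Nn; apply: lt_le_trans aN _.
by apply: ereal_inf_lbound; exists n.
Qed.

Lemma limn_einf_ge_near (R : realType) (u : nat -> \bar R) a :
  (\forall n \near \oo, (a <= u n)%E) -> (a <= limn_einf u)%E.
Proof.
rewrite limn_einf_lim (cvg_lim _ (@cvg_einfs_sup R u))// => -[N _ Nu].
apply: (@le_trans _ _ (einfs u N)); last by apply: ereal_sup_ubound; exists N.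
by apply: le_ereal_inf_tmp => _ [n /= Nn <-]; exact: Nu.
Qed.

Lemma shifted_union_return (X : Type) (T : X -> X) (x : X) (V : set X) (N k : nat) :
  shifted_union (return_times T x V) N k%:Z <->
  exists2 r, (r <= N)%N & V (iter r T (iter k T x)).
Proof.
split=> [[r /= rN [n Vn kE]]|[r rN Vr]].
  exists r => //; rewrite -iterD.
  suff -> : (r + k)%N = n by [].
  by apply/eqP; rewrite -eqz_nat PoszD kE addrC subrK.
exists r => //; exists (r + k)%N; first by rewrite /return_times /= iterD.
by rewrite PoszD addrC addKr.
Qed.

Lemma indic01 (R : realType) (Y : Type) (A : set Y) (y : Y) :
  0 <= (\1_A y : R) <= 1.
Proof. by rewrite indicE; case: (y \in A); rewrite /= ?lexx ?ler01. Qed.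

(** * Empirical measures along an orbit *)

Section empirical.
Context (R : realType) (X : Type) (T : X -> X) (x : X).

(** Times run from 1 to [M.+1]: the denominator never vanishes, and the average matches the one at
    index [M.+1] in [lower_dens]. *)
Definition empirical (M : nat) (A : set X) : R :=
  (\sum_(1 <= k < M.+2) \1_A (iter k T x)) / M.+1%:R.

Lemma empirical01 M A : 0 <= empirical M A <= 1.
Proof.
apply/andP; split.
  by apply: divr_ge0 => //; apply: sumr_ge0 => k _; case/andP: (indic01 R A (iter k T x)).
rewrite ler_pdivrMr// mul1r.
apply: (@le_trans _ _ (\sum_(1 <= k < M.+2) 1)).
  by apply: ler_sum => k _; case/andP: (indic01 R A (iter k T x)).
by rewrite sumr_const_nat subSS subn0.
Qed.

Lemma empirical_setT M : empirical M setT = 1.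
Proof.
rewrite /empirical (eq_bigr (fun=> 1)); last by move=> k _; rewrite indicT.
by rewrite sumr_const_nat subSS subn0 divff.
Qed.

Lemma empirical_setU M A B : A `&` B = set0 ->
  empirical M (A `|` B) = empirical M A + empirical M B.
Proof.
move=> AB; rewrite /empirical -mulrDl -big_split/=; congr (_ / _).
apply: eq_bigr => k _; rewrite !indicE in_setU.
case: (boolP (_ \in A)) => kA; case: (boolP (_ \in B)) => kB /=; rewrite ?addr0 ?add0r//.
have : (A `&` B) (iter k T x) by split; exact: set_mem.
by rewrite AB.
Qed.

(** The difference telescopes to two indicator values divided by [M.+1]. *)
Lemma empirical_preimage A :
  (fun M => empirical M (T @^-1` A) - empirical M A) @ \oo --> 0.
Proof.
apply/cvgr0Pnorm_lt => e e0; near=> M.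
rewrite /empirical -mulrBl -sumrB.
rewrite (telescope_sumr (fun k => \1_A (iter k T x)))//.
rewrite normrM normfV [`|M.+1%:R|]ger0_norm//.
apply: (@le_lt_trans _ _ (1 / M.+1%:R)).
  apply: ler_wpM2r => //; rewrite ler_norml.
  have := indic01 R A (iter M.+2 T x); have := indic01 R A (iter 1 T x).
  move: (\1_A _) (\1_A _) => a b; lra.
by rewrite mul1r; near: M; exact: (near_infty_natSinv_lt (PosNum e0)).
Unshelve. all: by end_near. Qed.
End empirical.

Lemma lower_dens_empirical (R : realType) (X : Type) (T : X -> X) (x : X)
    (V L : set X) (N : nat) (a : R) : V `<=` L ->
  (a%:E < lower_dens R (shifted_union (return_times T x V) N))%E ->
  \forall M \near \oo,
    a <= empirical R T x M (\big[setU/set0]_(r < N.+1) (iter r T @^-1` L)).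
Proof.
move=> VL /limn_einf_gt_near [M0 _ hM]; exists M0 => // M /= M0M.
have /(_ (leqW M0M)) := hM M.+1; rewrite lte_fin => /ltW /le_trans; apply.
apply: ler_wpM2r => //; apply: ler_sum => k _; rewrite !indicE ler_nat.
case: (boolP (_ \in shifted_union _ _)) => //= /set_mem /shifted_union_return [r rN Vr].
rewrite lt0b mem_set// -(bigcup_mkord _ (fun r => iter r T @^-1` L)).
by exists r => //; exact: VL.
Qed.

(** * From dense return times to an ergodic measure *)

Section dense_return_times_ergodic.
Context (R : realType) (d : measure_display) (X : measurableType d).
Context (tauX tau : set (set X)) (T : X -> X).
Hypotheses (htauX : is_topology tauX) (hpolish : polish_top R tauX).
Hypothesis hborel : @measurable d X = <<s tauX >>.
Hypotheses (htau : is_topology tau) (hcoarse : coarser tau tauX).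
Hypotheses (hhaus : hausdorff_top tau) (hbasis : compact_nbhs_basis tauX tau).
Hypothesis hThomeo : homeomorphism_in tau T.

Lemma dense_return_times_ergodic :
  (exists x0 : X, forall V : set X, tauX V -> V !=set0 ->
     (fun N : nat => lower_dens R (shifted_union (return_times T x0 V) N))
       @ \oo --> 1%E) ->
  exists mu : probability X R, ergodic_measure T mu /\ full_support tauX mu.
Proof.
move=> [x0 hx0].
have [B [oB B0 netB]] := polish_countable_base hpolish.
have [K [cK KI netK]] := countable_compact_net htau hhaus hbasis oB netB.
(* Every [tauX]-open set is a countable union of members of [K], which are [tau]-compact; hence both
   topologies have the same Borel sets. *)
have htausigma : @measurable d X = <<s tau >>.
  rewrite hborel; apply/seteqP; split; apply: sigma_algebra_sub_gen.
    apply: subset_trans (countable_net_sigma netK) _.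
    apply: sigma_algebra_sub_gen => _ [i _ <-]; exact: compact_in_sigma.
  by move=> U /hcoarse; exact: sub_sigma_algebra.
have cm A : compact_in tau A -> measurable A.
  by rewrite htausigma; exact: compact_in_sigma.
have hK : @measurable d X = <<s range K >>.
  rewrite hborel; apply/seteqP; split; apply: sigma_algebra_sub_gen.
    exact: countable_net_sigma.
  by move=> _ [i _ <-]; rewrite -hborel; exact: cm.
have Kcover : \bigcup_i K i = setT.
  apply/seteqP; split => // x _; have [|//|i [Kx _]] := netK setT x.
    by case: htauX.
  by exists i.
have [S [_ _ cT _]] := hThomeo.
(* The error [(8 * 4 ^+ i)^-1] is the one that gives the limit measure [m0] a finite penalty. *)
have /choice[LN hLN] i : exists LN : set X * nat, [/\ compact_in tau LN.1,
    LN.1 `<=` B i & \forall M \near \oo, 1 - (8 * 4 ^+ i)^-1 <=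
    empirical R T x0 M (\big[setU/set0]_(r < LN.2.+1) (iter r T @^-1` LN.1))].
  have [x Bx] := B0 i.
  have [L [[W [oW Wx WL]] LB cL]] := hbasis (oB i) Bx.
  have [N hN] : exists N, ((1 - (8 * 4 ^+ i)^-1)%:E <
      lower_dens R (shifted_union (return_times T x0 W) N))%E.
    apply: contrapT => hN.
    have : (1 <= (1 - (8 * 4 ^+ i)^-1)%:E :> \bar R)%E.
      apply: (cvge_to_le (hx0 W oW _)); first by exists x.
      by near=> N; rewrite leNgt; apply/negP => h; apply: hN; exists N.
    have e0 : 0 < (8 * 4 ^+ i)^-1 :> R by rewrite invr_gt0 mulr_gt0 ?exprn_gt0.
    by rewrite lee_fin lerBrDl gerDr leNgt e0.
  by exists (L, N); split => //=; exact: lower_dens_empirical hN.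
(* These compact sets make the empirical measures tight; moreover an invariant measure charging
   [C i] charges [(LN i).1], hence [B i]. *)
pose C i := \big[setU/set0]_(r < (LN i).2.+1) (iter r T @^-1` (LN i).1).
have cTr r A : compact_in tau A -> compact_in tau (iter r T @^-1` A).
  elim: r A => [//|r ih] A cA.
  have -> : iter r.+1 T @^-1` A = iter r T @^-1` (T @^-1` A) by [].
  exact: (ih _ (homeomorphism_in_compact_preimage hThomeo cA)).
have cC i : compact_in tau (C i).
  have [cL _ _] := hLN i.
  exact: (@compact_in_bigsetU _ _ _ (fun r => iter r T @^-1` (LN i).1)
    (fun r => cTr r _ cL)).
have [||||e e0|G [p [m0 [PG ooG up [m0T m0f] pm]]]] :=
  @tight_limit_measure R d X tau (empirical R T x0) T htau hhaus htausigma hThomeo.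
- by move=> M A _; exact: empirical01.
- by near=> M; exact: empirical_setT.
- by move=> M A C' _ _; exact: empirical_setU.
- by move=> U _; exact: empirical_preimage.
- have [i hi] : exists i, (8 * 4 ^+ i)^-1 < e.
    exists (Num.bound e^-1); set k := Num.bound _.
    have p4 : 0 < 4 ^+ k :> R by rewrite exprn_gt0.
    have h2 : k%:R <= 4 ^+ k :> R by rewrite -natrX ler_nat ltnW// ltn_expl.
    have h1 : e^-1 < k%:R by apply: archi_boundP; rewrite invr_ge0 ltW.
    rewrite invf_plt ?posrE ?mulr_gt0//.
    apply: lt_le_trans h1 (le_trans h2 _).
    by apply: ler_peMl; [exact: ltW|rewrite ler1n].
  exists (C i) => //; have [_ _ h] := hLN i.
  near=> M; apply: (@le_trans _ _ (1 - (8 * 4 ^+ i)^-1)).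
    by rewrite lerB// ltW.
  by near: M; exact: h.
have m0C i : 1 - fine (m0 (C i)) <= (8 * 4 ^+ i)^-1.
  rewrite lerBlDr -lerBlDl; have [_ _ h] := hLN i.
  apply: (@le_trans _ _ (p (C i))).
    by apply: (cvgr_to_ge (up _ (cm _ (cC i)))); exact: ooG.
  rewrite -lee_fin unit_mass_fineK//; [exact: pm|exact: cm].
have [m [me mC]] := exists_ergodic_charging htau hhaus htausigma hThomeo cC cK
  KI Kcover hK (conj m0T m0f) m0C.
exists m; split => // U oU [x Ux]; rewrite lt0e measure_ge0 andbT.
apply/eqP => mU0; have [i [Bx BU]] := netB U x oU Ux.
have [cL LB _] := hLN i; have mL := cm _ cL.
have mU : measurable U by rewrite hborel; exact: sub_sigma_algebra.
have L0 : m (LN i).1 = 0%E.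
  apply/eqP; rewrite -measure_le0 -mU0 le_measure ?inE//.
  by move=> y /LB /BU.
have L0r r : m (iter r T @^-1` (LN i).1) = 0%E.
  elim: r => [//|r ih]; have [minv _] := me.
  rewrite (_ : iter r.+1 T @^-1` _ = T @^-1` (iter r T @^-1` (LN i).1)).
    by rewrite minv//; apply: cm; exact: cTr.
  by apply/seteqP; split => y /=; rewrite -iterSr.
have := mC i; rewrite lt0e => /andP[/eqP + _]; apply.
have : m.-negligible (C i).
  rewrite /C -(big_mkord xpredT (fun r => iter r T @^-1` (LN i).1)).
  apply: negligible_bigsetU => r _; exists (iter r T @^-1` (LN i).1).
  by split; [apply: cm; exact: cTr|exact: L0r|].
by move=> /negligibleP; apply; exact: cm.
Unshelve. all: by end_near. Qed.
End dense_return_times_ergodic.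

(** * A one-sided Birkhoff theorem *)

Section birkhoff_lower_bound.
Context (R : realType) (d : measure_display) (X : measurableType d).
Context (T : X -> X) (m : probability X R) (A : set X) (a : R).
Hypotheses (mT : measurable_fun setT T) (mA : measurable A) (a0 : 0 <= a).

Definition deficit (x : X) : R := a - \1_A x.

Definition birkhoff_sum (n : nat) (x : X) : R :=
  \sum_(k < n) deficit (iter k T x).

(* Equals max_(0 <= j <= n) birkhoff_sum j x. *)
Fixpoint birkhoff_max (n : nat) (x : X) : R :=
  if n is n'.+1 then Num.max 0 (deficit x + birkhoff_max n' (T x)) else 0.

Lemma birkhoff_sumS n x :
  birkhoff_sum n.+1 x = deficit x + birkhoff_sum n (T x).
Proof.
rewrite /birkhoff_sum big_ord_recl; congr (_ + _).
by apply: eq_bigr => k _; rewrite /= -iterSr.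
Qed.

Lemma birkhoff_max_ge0 n x : 0 <= birkhoff_max n x.
Proof. by case: n => //= n; rewrite le_max lexx. Qed.

Lemma birkhoff_max_le n x : birkhoff_max n x <= a *+ n.
Proof.
elim: n x => [|n ih] x /=; first by rewrite mulr0n.
rewrite ge_max mulrn_wge0//= mulrS lerD// /deficit gerBl.
by case/andP: (indic01 R A x).
Qed.

Lemma birkhoff_maxS n x : birkhoff_max n x <= birkhoff_max n.+1 x.
Proof.
elim: n x => [|n ih] x; first exact: birkhoff_max_ge0.
rewrite /= ge_max le_max lexx/= le_max; apply/orP; right.
by rewrite lerD2l ih.
Qed.

Lemma birkhoff_max_mono n k x : (n <= k)%N -> birkhoff_max n x <= birkhoff_max k x.
Proof.
elim: k => [|k ih]; first by rewrite leqn0 => /eqP ->.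
rewrite leq_eqVlt => /orP[/eqP ->//|]; rewrite ltnS => /ih /le_trans; apply.
exact: birkhoff_maxS.
Qed.

Lemma birkhoff_sum_le_max n x : birkhoff_sum n x <= birkhoff_max n x.
Proof.
elim: n x => [|n ih] x; first by rewrite /birkhoff_sum big_ord0.
by rewrite birkhoff_sumS /= le_max lerD2l ih orbT.
Qed.

Lemma measurable_deficit : measurable_fun setT deficit.
Proof.
by apply: measurable_funB; [exact: measurable_cst|exact: measurable_indic].
Qed.

Lemma measurable_iter k : measurable_fun setT (iter k T).
Proof.
elim: k => [|k ih]; first exact: measurable_id.
exact: (measurableT_comp mT ih).
Qed.

Lemma measurable_birkhoff_sum n : measurable_fun setT (birkhoff_sum n).
Proof.
apply: measurable_sum => k.
exact: (measurableT_comp measurable_deficit (measurable_iter k)).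
Qed.

Lemma measurable_birkhoff_max n : measurable_fun setT (birkhoff_max n).
Proof.
elim: n => [|n ih]; first exact: measurable_cst.
apply: measurable_maxr; first exact: measurable_cst.
by apply: measurable_funD; [exact: measurable_deficit|exact: (measurableT_comp ih mT)].
Qed.

Definition birkhoff_pos (n : nat) : set X := [set x | 0 < birkhoff_max n x].

Lemma measurable_gt (f : X -> R) c : measurable_fun setT f ->
  measurable [set x | c < f x].
Proof.
move=> mf; rewrite -[X in measurable X]setTI.
rewrite (_ : [set x | c < f x] = f @^-1` `]c, +oo[); first exact: mf.
by apply/seteqP; split => x /=; rewrite in_itv/= andbT.
Qed.

Lemma measurable_birkhoff_pos n : measurable (birkhoff_pos n).
Proof. exact: measurable_gt (measurable_birkhoff_max n). Qed.

(** Where [birkhoff_max n x] is positive, it is at most [birkhoff_max n.+1 x], whose recursion then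
    yields [deficit x + birkhoff_max n (T x)]. Elsewhere it is 0. *)
Lemma birkhoff_max_coboundary n x :
  birkhoff_max n x + \1_(birkhoff_pos n `&` A) x <=
  birkhoff_max n (T x) + a * \1_(birkhoff_pos n) x.
Proof.
rewrite !indicE in_setI; have [px|npx] := boolP (x \in birkhoff_pos n).
  move/set_mem : (px); rewrite /birkhoff_pos /= => px0.
  have := birkhoff_maxS n x; rewrite [birkhoff_max n.+1 x]/= le_max.
  rewrite leNgt px0 /= /deficit indicE mulr1; lra.
have nx0 : birkhoff_max n x <= 0.
  by rewrite leNgt; apply: contra npx => h; exact: mem_set.
by have := birkhoff_max_ge0 n (T x); rewrite /= mulr0; lra.
Qed.

Hypothesis minv : invariant_measure T m.

(** Integrating the pointwise inequality: by invariance both integrals of [birkhoff_max n] agree,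
    and they cancel, being finite by the bound [a *+ n]. *)
Lemma maximal_ergodic_indic n :
  (m (birkhoff_pos n `&` A) <= a%:E * m (birkhoff_pos n))%E.
Proof.
have mP := measurable_birkhoff_pos n.
have mPA : measurable (birkhoff_pos n `&` A) by exact: measurableI.
have mM : measurable_fun setT (EFin \o birkhoff_max n).
  by apply/measurable_EFinP; exact: measurable_birkhoff_max.
have mMT : measurable_fun setT (EFin \o (birkhoff_max n \o T)).
  by apply/measurable_EFinP; apply: measurableT_comp => //;
    exact: measurable_birkhoff_max.
have mI (B : set X) : measurable B -> measurable_fun setT (fun x => (\1_B x : R)%:E).
  by move=> mB; apply/measurable_EFinP; exact: measurable_indic.
have I0 (B : set X) x : (0 <= (\1_B x : R)%:E)%E.
  by rewrite lee_fin; case/andP: (indic01 R B x).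
have M0 x : (0 <= (birkhoff_max n x)%:E)%E by rewrite lee_fin birkhoff_max_ge0.
have intT : (\int[m]_x (birkhoff_max n (T x))%:E = \int[m]_x (birkhoff_max n x)%:E)%E.
  rewrite -(@ge0_integral_pushforward _ _ _ _ _ _ mT m setT
    (EFin \o birkhoff_max n))//; last by move=> y _; exact: M0.
  by apply: eq_measure_integral => B mB _; exact: minv.
have fin : (\int[m]_x (birkhoff_max n x)%:E)%E \is a fin_num.
  rewrite ge0_fin_numE; last exact: integral_ge0.
  apply: (@le_lt_trans _ _ (\int[m]_x (cst (a *+ n)%:E x))%E).
    apply: ge0_le_integral => //.
    by move=> x _; rewrite lee_fin birkhoff_max_le.
  rewrite integral_cst//; apply: (@eq_ind_r _ 1%E (fun z => (_ * z < +oo)%E));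
    last exact: probability_setT.
  by rewrite mule1 ltry.
rewrite -(leeD2lE _ _ fin).
have <- : (\int[m]_x ((birkhoff_max n x)%:E + (\1_(birkhoff_pos n `&` A) x)%:E) =
    \int[m]_x (birkhoff_max n x)%:E + m (birkhoff_pos n `&` A))%E.
  rewrite ge0_integralD//; last exact: mI.
  by rewrite integral_indic// setIT.
rewrite -[in leRHS]intT.
have <- : (\int[m]_x ((birkhoff_max n (T x))%:E + a%:E * (\1_(birkhoff_pos n) x)%:E) =
    \int[m]_x (birkhoff_max n (T x))%:E + a%:E * m (birkhoff_pos n))%E.
  rewrite ge0_integralD//.
  - by rewrite ge0_integralZl_EFin// ?integral_indic ?setIT//; exact: mI.
  - by move=> x _; rewrite mule_ge0// lee_fin.
  - by apply: measurable_funeM; exact: mI.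
apply: ge0_le_integral => //.
- by move=> x _; rewrite adde_ge0.
- by apply: emeasurable_funD => //; exact: mI.
- by apply: emeasurable_funD => //; apply: measurable_funeM; exact: mI.
- by move=> x _; rewrite -EFinM -!EFinD lee_fin birkhoff_max_coboundary.
Qed.

Definition birkhoff_unbounded : set X :=
  [set x | forall c : nat, exists n, c%:R < birkhoff_sum n x].

Lemma measurable_birkhoff_unbounded : measurable birkhoff_unbounded.
Proof.
rewrite (_ : birkhoff_unbounded =
    \bigcap_c \bigcup_n [set x | c%:R < birkhoff_sum n x]).
  apply: bigcapT_measurable => c; apply: bigcup_measurable => n _.
  exact: measurable_gt (measurable_birkhoff_sum n).
apply/seteqP; split => [x h c _|x h c].
  by have [n hn] := h c; exists n.
by have [n _ hn] := h c I; exists n.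
Qed.

Lemma birkhoff_unbounded_invariant : T @^-1` birkhoff_unbounded = birkhoff_unbounded.
Proof.
apply/seteqP; split => [x h c|x h c].
  (* The extra term [deficit x] is at least [-1], which the threshold [c.+1] absorbs. *)
  have [n hn] := h c.+1; exists n.+1; rewrite birkhoff_sumS.
  have := indic01 R A x; move: hn; rewrite -natr1 /deficit.
  by move: a0 (\1_A x) => ? y; lra.
(* Conversely [deficit x] is at most [a]; the empty sum cannot exceed the nonnegative threshold. *)
have [n] := h (c + Num.bound a)%N; case: n => [|n].
  by rewrite /birkhoff_sum big_ord0 ltNge ler0n.
rewrite birkhoff_sumS natrD => hn; exists n.
have := indic01 R A x; have := archi_boundP a0; move: hn; rewrite /deficit.
by move: (\1_A x) (birkhoff_sum _ _) => y z; lra.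
Qed.

(** Otherwise ergodicity gives the set mass 1, the mass of [birkhoff_pos n] tends to 1, and the
    maximal inequality yields [m A <= a] in the limit. *)
Lemma birkhoff_unbounded_null : ergodic_measure T m -> (a%:E < m A)%E ->
  m birkhoff_unbounded = 0%E.
Proof.
move=> [_ erg] aA.
have [//|B1] := erg _ measurable_birkhoff_unbounded birkhoff_unbounded_invariant.
exfalso.
have cvg1 : (m \o birkhoff_pos) n @[n --> \oo] --> 1%E.
  have U1 : m (\bigcup_n birkhoff_pos n) = 1%E.
    apply/eqP; rewrite eq_le probability_le1/=; last first.
      by apply: bigcup_measurable => n _; exact: measurable_birkhoff_pos.
    rewrite -B1 le_measure ?inE//.
    - exact: measurable_birkhoff_unbounded.
    - by apply: bigcup_measurable => n _; exact: measurable_birkhoff_pos.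
    move=> x /(_ 0%N) [n hn]; exists n => //.
    exact: lt_le_trans hn (birkhoff_sum_le_max n x).
  rewrite -U1; apply: nondecreasing_cvg_mu.
  - exact: measurable_birkhoff_pos.
  - by apply: bigcup_measurable => n _; exact: measurable_birkhoff_pos.
  - move=> n k nk; apply/subsetPset => x; rewrite /birkhoff_pos /= => /lt_le_trans; apply.
    exact: birkhoff_max_mono.
have mT1 : m setT = 1%E by exact: probability_setT.
have /fine_cvgP[_ cvgf] := cvg1.
have aA' : a < fine (m A) by rewrite -lte_fin unit_mass_fineK.
(* Splitting [A] along [P = birkhoff_pos n] gives [m A <= a * m P + (1 - m P) <= a + 1 - m P]. *)
have : 1 <= 1 + a - fine (m A); last by lra.
apply: (cvgr_to_le cvgf); near=> n => /=.
have mP := measurable_birkhoff_pos n.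
have /= mC : measurable (~` birkhoff_pos n) by exact: measurableC.
have := unit_mass_split mT1 mA mP.
have := unit_mass_setC mT1 mP.
have : fine (m (A `&` ~` birkhoff_pos n)) <= fine (m (~` birkhoff_pos n)).
  rewrite -lee_fin !unit_mass_fineK//; last exact: measurableI.
  by rewrite le_measure ?inE//; exact: measurableI.
have : fine (m (A `&` birkhoff_pos n)) <= a * fine (m (birkhoff_pos n)).
  rewrite -lee_fin EFinM !unit_mass_fineK//; last exact: measurableI.
  by rewrite setIC; exact: maximal_ergodic_indic.
have /andP[] := unit_mass_le1 mT1 mP.
move=> h0 h1 h2 h3 h4 h5.
have : a * fine (m (birkhoff_pos n)) <= a by rewrite ler_piMr.
lra.
Unshelve. all: by end_near. Qed.
End birkhoff_lower_bound.

Lemma lower_dens01 (R : realType) (D : set int) :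
  (0 <= lower_dens R D <= 1)%E.
Proof.
have av M : 0 <= (\sum_(1 <= k < M.+1) (\1_D k%:Z : R)) / M%:R <= 1.
  apply/andP; split.
    by apply: divr_ge0 => //; apply: sumr_ge0 => k _; case/andP: (indic01 R D k%:Z).
  (* At [M = 0] the average is 0, because the inverse of 0 is 0. *)
  have [->|M0] := posnP M; first by rewrite invr0 mulr0 ler01.
  rewrite ler_pdivrMr ?ltr0n// mul1r.
  apply: (@le_trans _ _ (\sum_(1 <= k < M.+1) 1)).
    by apply: ler_sum => k _; case/andP: (indic01 R D k%:Z).
  by rewrite sumr_const_nat subSS subn0.
apply/andP; split.
  by apply: limn_einf_ge_near; near=> M; rewrite lee_fin; case/andP: (av M).
rewrite leNgt; apply/negP => /limn_einf_gt_near [N _ /(_ N (leqnn N))].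
by rewrite /= lte_fin ltNge => /negP; apply; case/andP: (av N).
Unshelve. all: by end_near. Qed.

(** * Visits within a bounded time *)

Section visits.
Context (R : realType) (d : measure_display) (X : measurableType d).
Context (T : X -> X) (m : probability X R).
Hypotheses (mT : measurable_fun setT T) (erg : ergodic_measure T m).

Let mT1 : m setT = 1%E. Proof. exact: probability_setT. Qed.

Definition visits_before (V : set X) (N : nat) : set X :=
  \bigcup_(r in [set r | (r <= N)%N]) (iter r T @^-1` V).

Let mTr r V : measurable V -> measurable (iter r T @^-1` V).
Proof.
move=> mV; rewrite -[X in measurable X]setTI.
exact: (measurable_iter mT r).
Qed.

Let miter r V : measurable V -> m (iter r T @^-1` V) = m V.
Proof.
have [minv _] := erg; elim: r V => [//|r ih] V mV.
rewrite (_ : iter r.+1 T @^-1` V = iter r T @^-1` (T @^-1` V))//.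
by rewrite ih ?minv//; exact: (mTr 1).
Qed.

Lemma measurable_visits V N : measurable V -> measurable (visits_before V N).
Proof. by move=> mV; apply: bigcup_measurable => r _; exact: mTr. Qed.

(** The set [A] of points that ever visit [V] satisfies only [T^-1 A] included in [A]. The
    intersection of its iterated preimages is strictly invariant and has the same mass, so
    ergodicity applies to it. *)
Lemma visits_ever_full V : measurable V -> (0 < m V)%E ->
  m (\bigcup_r (iter r T @^-1` V)) = 1%E.
Proof.
move=> mV V0; set A := \bigcup_r _.
have mA : measurable A by apply: bigcup_measurable => r _; exact: mTr.
pose F n := iter n T @^-1` A.
have mF n : measurable (F n) by exact: mTr.
have FS n : F n.+1 `<=` F n.
  move=> x [r _ Vr]; exists r.+1 => //.
  by rewrite /= -iterS -iterSr in Vr *.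
have Fle n k : (n <= k)%N -> F k `<=` F n.
  elim: k => [|k ih]; first by rewrite leqn0 => /eqP ->.
  rewrite leq_eqVlt => /orP[/eqP ->//|]; rewrite ltnS => /ih.
  by apply: subset_trans; exact: FS.
have mD : measurable (\bigcap_n F n) by exact: bigcapT_measurable.
have invD : T @^-1` (\bigcap_n F n) = \bigcap_n F n.
  apply/seteqP; split => [x Dx n _|x Dx n _].
    by apply: FS; rewrite /F /= -iterS iterSr; exact: Dx.
  by have := Dx n.+1 I; rewrite /F /= -iterS iterSr.
have DA : m (\bigcap_n F n) = m A.
  apply: (@cvg_unique _ (@ereal_hausdorff R) ((m \o F) n @[n --> \oo])).
    apply: nonincreasing_cvg_mu => //.
      apply: (@le_lt_trans _ _ 1%E); last exact: ltry.
      exact: probability_le1.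
    by move=> n k nk; apply/subsetPset; exact: Fle.
  by rewrite (_ : m \o F = cst (m A)); [exact: cvg_cst|
    apply/funext => n; exact: miter].
have [_ /(_ _ mD invD)] := erg; rewrite DA => -[A0|//].
exfalso; move: V0; rewrite ltNge => /negP; apply.
rewrite -A0 le_measure ?inE// => x Vx; by exists 0%N.
Qed.

Lemma visits_before_large V (e : R) : measurable V -> (0 < m V)%E -> 0 < e ->
  exists N, ((1 - e)%:E < m (visits_before V N))%E.
Proof.
move=> mV V0 e0; apply: contrapT => h.
have VE : \bigcup_N visits_before V N = \bigcup_r (iter r T @^-1` V).
  apply/seteqP; split => [x [N _ [r _ Vr]]|x [r _ Vr]]; first by exists r.
  by exists r => //; exists r => /=.
have cvg1 : (m \o visits_before V) N @[N --> \oo] --> m (\bigcup_N visits_before V N).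
  apply: nondecreasing_cvg_mu.
  - by move=> N; exact: measurable_visits.
  - by apply: bigcup_measurable => N _; exact: measurable_visits.
  - move=> n k nk; apply/subsetPset => x [r /= rn Vr]; exists r => //=.
    exact: leq_trans nk.
rewrite VE visits_ever_full// in cvg1.
have : (1 <= (1 - e)%:E :> \bar R)%E.
  apply: (cvge_to_le cvg1); near=> N; rewrite leNgt; apply/negP => hN.
  by apply: h; exists N.
by rewrite lee_fin lerBrDl gerDr leNgt e0.
Unshelve. all: by end_near. Qed.

(* Dropping the k = 0 term costs at most 1, hence the slack c + 1. *)
Lemma bounded_birkhoff_lower_dens V N (e : R) (c : nat) x :
  0 < e -> e <= 1 ->
  (forall n, birkhoff_sum T (visits_before V N) (1 - e) n x <= c%:R) ->
  ((1 - 2 * e)%:E <=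
    lower_dens R (shifted_union (return_times T x V) N))%E.
Proof.
move=> e0 e1 hc; apply: limn_einf_ge_near.
near=> M; rewrite lee_fin.
have M0 : (0 < M)%N by near: M; exact: nbhs_infty_gt.
have Me : (c%:R + 1) / e < M%:R.
  by near: M; exact: nbhs_infty_gtr.
rewrite ler_pdivlMr ?ltr0n//.
have := hc M.+1; rewrite /birkhoff_sum /deficit sumrB.
rewrite sumr_const card_ord.
rewrite -(big_mkord xpredT (fun k => \1_(visits_before V N) (iter k T x) : R)).
rewrite big_nat_recl//=.
have sumE : \sum_(0 <= k < M) (\1_(visits_before V N) (T (iter k T x)) : R) =
   \sum_(1 <= k < M.+1) (\1_(shifted_union (return_times T x V) N) k%:Z : R).
  rewrite big_add1 /=; apply: eq_bigr => k _; rewrite !indicE; congr (_%:R).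
  congr nat_of_bool; apply/idP/idP => /set_mem h; apply: mem_set.
    by case: h => r rN Vr; apply/shifted_union_return; exists r.
  by move/shifted_union_return : h => [r rN Vr]; exists r.
rewrite sumE; have /andP[_] := indic01 R (visits_before V N) x.
move: Me; rewrite ltr_pdivrMr// -[(1 - e) *+ _]mulr_natr -[M.+1%:R]natr1.
move: (\sum_(1 <= k < M.+1) _) (\1_ _ x) => s y; move: M%:R c%:R => z w; lra.
Unshelve. all: by end_near. Qed.
End visits.

Lemma shifted_unionS (D D' : set nat) (N N' : nat) : D `<=` D' -> (N <= N')%N ->
  shifted_union D N `<=` shifted_union D' N'.
Proof.
move=> DD' NN' z [r /= rN [k Dk ->]]; exists r; first exact: leq_trans NN'.
by exists k => //; exact: DD'.
Qed.


Lemma le_limn_einf (R : realType) (u v : nat -> \bar R) :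
  (forall n, (u n <= v n)%E) -> (limn_einf u <= limn_einf v)%E.
Proof.
move=> uv; rewrite !limn_einf_lim; apply: lee_lim; [exact: is_cvg_einfs|
  exact: is_cvg_einfs|near=> n].
apply: le_ereal_inf_tmp => _ [k /= nk <-]; apply: le_trans (uv k).
by apply: ereal_inf_lbound; exists k.
Unshelve. all: by end_near. Qed.

Lemma lower_densS (R : realType) (D D' : set int) : D `<=` D' ->
  (lower_dens R D <= lower_dens R D')%E.
Proof.
move=> DD'; apply: le_limn_einf => M; rewrite lee_fin.
apply: ler_wpM2r => //; apply: ler_sum => k _; rewrite !indicE ler_nat.
by case: (boolP (_ \in D)) => //= /set_mem /DD' Dk; rewrite lt0b mem_set.
Qed.

(** * From an ergodic measure to dense return times *)

Section ergodic_orbit.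
Context (R : realType) (d : measure_display) (X : measurableType d).
Context (tauX : set (set X)) (T : X -> X).
Hypotheses (hpolish : polish_top R tauX) (hborel : @measurable d X = <<s tauX >>).
Hypothesis hTcont : continuous_in tauX T.

Lemma ergodic_dense_return_times :
  (exists mu : probability X R, ergodic_measure T mu /\ full_support tauX mu) ->
  exists x0 : X, forall V : set X, tauX V -> V !=set0 ->
     (fun N : nat => lower_dens R (shifted_union (return_times T x0 V) N))
       @ \oo --> 1%E.
Proof.
move=> [m [erg full]].
have mT : measurable_fun setT T.
  by move=> _ A mA; rewrite setTI; exact: continuous_in_measurable hborel hTcont mA.
have [B [oB B0 netB]] := polish_countable_base hpolish.
have mB i : measurable (B i) by rewrite hborel; exact: sub_sigma_algebra.
pose e k : R := k.+1%:R^-1.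
have e0 k : 0 < e k by rewrite invr_gt0.
have e1 k : e k <= 1 by rewrite invf_le1// ler1n.
have /choice[N hN] (ik : nat * nat) :
    exists N, ((1 - e ik.2)%:E < m (visits_before T (B ik.1) N))%E.
  by apply: visits_before_large => //; exact: full.
(* One null set per basic set and precision: their countable union is null, so some [x0] avoids them
   all. *)
pose bad ik := birkhoff_unbounded T (visits_before T (B ik.1) (N ik)) (1 - e ik.2).
have bad0 ik : m.-negligible (bad ik).
  have mV : measurable (visits_before T (B ik.1) (N ik)) by exact: measurable_visits.
  have e1' : 0 <= 1 - e ik.2 by rewrite subr_ge0.
  exists (bad ik); split => //; first exact: measurable_birkhoff_unbounded.
  by apply: birkhoff_unbounded_null => //; case: erg.
have [x0 hx0] : exists x0, forall ik, ~ bad ik x0.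
  apply: contrapT => h.
  have : m.-negligible (\bigcup_n (if unpickle n is Some ik then bad ik else set0)).
    by apply: negligible_bigcup => n; case: unpickle => [ik|];
      [exact: bad0|exact: negligible_set0].
  rewrite (_ : \bigcup_n _ = setT).
    move/negligibleP => /(_ measurableT) m0.
    have /eqP : 1%E = 0%E :> \bar R := etrans (esym (probability_setT m)) m0.
    by rewrite onee_eq0.
  apply/seteqP; split => // x _; apply: contrapT => hx; apply: h; exists x => ik bx.
  by apply: hx; exists (pickle ik) => //; rewrite pickleK.
exists x0 => V oV [y Vy]; have [i [By BV]] := netB V y oV Vy.
have dens01 n := lower_dens01 R (shifted_union (return_times T x0 V) n).
apply/fine_cvgP; split.
  near=> n; have /andP[h0 h1] := dens01 n.
  by rewrite ge0_fin_numE//; apply: le_lt_trans h1 (ltry _).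
apply/cvgrPdist_le => /= eps eps0.
(* One [e k] is lost in the mass of the visiting set, the other in absorbing the bound on the
   Birkhoff sums. *)
have [k hk] : exists k, 2 * e k <= eps.
  exists (Num.bound (2 / eps)); rewrite ler_pdivrMr// mulrC -ler_pdivrMr//.
  apply: ltW; apply: lt_trans (archi_boundP _) _; first by rewrite divr_ge0// ltW.
  by rewrite ltr_nat.
have [c hc] : exists c : nat, forall n, birkhoff_sum T
    (visits_before T (B i) (N (i, k))) (1 - e k) n x0 <= c%:R.
  apply: contrapT => h; apply: (hx0 (i, k)) => c; apply: contrapT => hc.
  apply: h; exists c => n; rewrite leNgt; apply/negP => hn.
  by apply: hc; exists n.
have := bounded_birkhoff_lower_dens (e0 k) (e1 k) hc => low.
near=> n; have /andP[h0 h1] := dens01 n.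
have nN : (N (i, k) <= n)%N by near: n; exact: nbhs_infty_ge.
have : ((1 - 2 * e k)%:E <=
    lower_dens R (shifted_union (return_times T x0 V) n))%E.
  apply: le_trans low (lower_densS _ _); apply: shifted_unionS => //.
  by move=> k' /BV.
have finn : lower_dens R (shifted_union (return_times T x0 V) n) \is a fin_num.
  by rewrite ge0_fin_numE//; apply: le_lt_trans h1 (ltry _).
move: h1; rewrite -(fineK finn) !lee_fin => h1 h2.
rewrite ger0_norm ?subr_ge0//; lra.
Unshelve. all: by end_near. Qed.
End ergodic_orbit.

Unset Implicit Arguments.

(* tauX : the Polish topology; tau : the coarser Hausdorff topology.
   The measurable sets of X are exactly the tauX-Borel sets. *)
Theorem proposition2 (R : realType) (d : measure_display) (X : measurableType d)
  (tauX tau : set (set X)) (T : X -> X)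
  (htauX : is_topology tauX) (hpolish : polish_top R tauX)
  (hborel : @measurable d X = <<s tauX >>)
  (hTcont : continuous_in tauX T)
  (htau : is_topology tau) (hcoarse : coarser tau tauX)
  (hhaus : hausdorff_top tau) (hbasis : compact_nbhs_basis tauX tau)
  (hThomeo : homeomorphism_in tau T) :
  (exists mu : probability X R, ergodic_measure T mu /\ full_support tauX mu) <->
  (exists x0 : X, forall V : set X, tauX V -> V !=set0 ->
     (fun N : nat => lower_dens R (shifted_union (return_times T x0 V) N))
       @ \oo --> 1%E).
Proof.
split; first exact: (ergodic_dense_return_times hpolish hborel hTcont).
exact: (dense_return_times_ergodic htauX hpolish hborel htau hcoarse hhaus hbasis
  hThomeo).
Qed.
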